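(* Let $0<r\le n$, $R=\{1,\ldots,r\}$, $N=\{1,\ldots,n\}$, and let $\psi:\widetilde{A}(r,d,\underline{\widetilde q})\to A(n,d,\underline q)$ be a $\Bbbk$-algebra homomorphism. Then there exist an injective map $w:R\to N$, $(\tau_1,\ldots,\tau_r)\in\{0,1\}^r$, $(m_1,\ldots,m_r)\in(\mathbb{Z}\setminus\{0\})^r$, $(\gamma_1,\ldots,\gamma_r),(b_1,\ldots,b_r)\in(\Bbbk^* )^r$, an integer matrix $(t_{i,j})\in\mathcal{M}_{r,n}(\mathbb{Z})$, and Laurent polynomials $p_i(h_{w(i)}),p_i'(h_{w(i)})\in\Bbbk[h_{w(i)}^{\pm1}]$ ($i\in R$) such that: (i) $q_{w(i)}^{(-1)^{\tau_i}m_i}=\widetilde q_i$ for all $i\in R$; (ii) $q_{w(i)}^{t_{l,w(i)}(1-\tau_i)}\,q_{w(i)}^{-t_{l,w(i)}\tau_i}\,q_{w(l)}^{-t_{i,w(l)}(1-\tau_l)}\,q_{w(l)}^{t_{i,w(l)}\tau_l}=1$ for all $i,l\in R$; (iii) $p_i(h_{w(i)})\,p_i'(h_{w(i)})\,a_d\big(q_{w(i)}^{1-\tau_i}h_{w(i)}\big)=a_d\big(\widetilde q_i\gamma_ih_{w(i)}^{m_i}\big)$ for all $i\in R$; (iv) $\gamma_i^d=\widetilde q_i^{-\tau_id}$ and, for all $i\in R$, $\psi(\widetilde h_i)=\gamma_ih_{w(i)}^{m_i}$, $\psi(\widetilde x_i)=p_i(h_{w(i)})\,b_i\,h_1^{t_{i,1}}\cdots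 h_n^{t_{i,n}}\,x_{w(i)}^{1-\tau_i}y_{w(i)}^{\tau_i}$, $\psi(\widetilde y_i)=x_{w(i)}^{\tau_i}y_{w(i)}^{1-\tau_i}\,p_i'(h_{w(i)})\,b_i^{-1}\,h_1^{-t_{i,1}}\cdots h_n^{-t_{i,n}}$.
   Context: Let $\Bbbk$ be a field, $d\ge1$, and write $a_d(X)=X^d-1$. For a positive integer $n$ and $\underline{q}=(q_1,\ldots,q_n)\in(\Bbbk^* )^n$ with $q_i^d\neq1$ for all $i$, $A(n,d,\underline{q})$ is the $\Bbbk$-algebra generated by $x_i,y_i,h_i,h_i^{-1}$ ($1\le i\le n$) subject to $h_ih_i^{-1}=h_i^{-1}h_i=1$, $x_ih_i=q_ih_ix_i$, $y_ih_i=q_i^{-1}h_iy_i$, $x_iy_i=(q_ih_i)^d-1$, $y_ix_i=h_i^d-1$, and, for $i\neq j$, each of $h_i^{\pm1},x_i,y_i$ commutes with each of $h_j^{\pm1},x_j,y_j$. For $\underline{\widetilde q}=(\widetilde q_1,\ldots,\widetilde q_r)\in(\Bbbk^* )^r$ with $\widetilde q_i^d\ne1$, $\widetilde A(r,d,\underline{\widetilde q})$ denotes the algebra $A(r,d,\underline{\widetilde q})$ with its generators written $\widetilde x_i,\widetilde y_i,\widetilde h_i^{\pm1}$. Exponents such as $x^{1-\tau_i}y^{\tau_i}$ with $\tau_i\in\{0,1\}$ mean $x$ if $\tau_i=0$ and $y$ if $\tau_i=1$. *)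

(* Defs.v *)
From HB Require Import structures.
From mathcomp Require Import all_boot all_order all_algebra.
Set Implicit Arguments. Unset Strict Implicit. Unset Printing Implicit Defensive.
Import Order.TTheory GRing.Theory Num.Theory.
Local Open Scope ring_scope.

Definition zpow (A : pzRingType) (h hi : A) (z : int) : A :=
  match z with
  | Posz m => h ^+ m
  | Negz m => hi ^+ m.+1
  end.

(* The Laurent polynomial  sum_k P_k X^(k+e)  evaluated at X = h
   (with h^{-1} = hi).  Every element of K[X^{+-1}] has this form. *)
Definition laurent_eval (K : fieldType) (A : algType K) (P : {poly K}) (e : int)
  (h hi : A) : A :=
  \sum_(k < size P) P`_k *: zpow h hi (k%:Z + e).

Definition a_d (A : pzRingType) (d : nat) (X : A) : A := X ^+ d - 1.

Definition GWA_rels (K : fieldType) (n d : nat) (q : 'I_n -> K) (A : algType K)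
  (x y h hi : 'I_n -> A) : Prop :=
  (forall i : 'I_n,
     [/\ h i * hi i = 1 /\ hi i * h i = 1,
         x i * h i = q i *: (h i * x i),
         y i * h i = (q i)^-1 *: (h i * y i),
         x i * y i = a_d d (q i *: h i) &
         y i * x i = a_d d (h i)]) /\
  (forall i j : 'I_n, i != j ->
     forall u v : A,
       u \in [:: h i; hi i; x i; y i] ->
       v \in [:: h j; hi j; x j; y j] -> u * v = v * u).

(* (A, x, y, h, hi) is the K-algebra generated by x_i, y_i, h_i, h_i^{-1}
   subject to the relations GWA_rels: the relations hold, and for every
   K-algebra B with elements satisfying the relations there is a unique
   (unital) K-algebra homomorphism A -> B sending generators to the given
   elements. *)
Definition is_A_presentation (K : fieldType) (n d : nat) (q : 'I_n -> K)
  (A : algType K) (x y h hi : 'I_n -> A) : Prop :=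
  GWA_rels d q x y h hi /\
  forall (B : algType K) (xB yB hB hiB : 'I_n -> B),
    GWA_rels d q xB yB hB hiB ->
    (exists f : {lrmorphism A -> B},
        forall i, [/\ f (x i) = xB i, f (y i) = yB i,
                      f (h i) = hB i & f (hi i) = hiB i]) /\
    (forall f g : {lrmorphism A -> B},
        (forall i, [/\ f (x i) = xB i, f (y i) = yB i,
                       f (h i) = hB i & f (hi i) = hiB i]) ->
        (forall i, [/\ g (x i) = xB i, g (y i) = yB i,
                       g (h i) = hB i & g (hi i) = hiB i]) ->
        f =1 g).

(* Main.v *)
Require Import Defs.
From HB Require Import structures.
From mathcomp Require Import all_boot all_order all_algebra.
From mathcomp Require Import finmap boolp.
From mathcomp Require Import monalg ring zify.
Set Implicit Arguments. Unset Strict Implicit. Unset Printing Implicit Defensive.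
Import Order.TTheory GRing.Theory Num.Theory.
Local Open Scope ring_scope.

(** The [q_j] may be roots of unity, so the degree of the image [X] of [x~_i] cannot be read off
    from its commutation with the image of [h~_i]. Homogeneity is extracted instead from the
    products [X Y] and [Y X], which are binomials in the [h_j], by absence of zero divisors. The
    vanishing property reflects the identity [y_j^k = prod_(0 <= s < k) ((q_j^-s h_j)^d - 1) .
    x_j^-k] in the torus. If two points [s = 0, 1] were available, a binomial [C h_j^(d m) - 1]
    would give [C = 1] and [C q_j^(d m) = 1], so that [q~_i^d], a power of [q_j^(d m)], would be 1.
    The one point [s = 0] that remains yields the value of [gamma_i^d]. What links different
    indices, namely injectivity of [w] and condition (ii), comes from comparing leading monomials in
    the commutation of [x~_i] with [h~_l] and with [x~_l]. *)

(** Sending [y_j] to [(h_j^d - 1) x_j^-1] embeds [A(n, d, q)] into the quantum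
    torus on [h_j, x_j]; injectivity holds since [A] is spanned by the monomials
    [h^al z^be], where [z_j^b] is [x_j^b] or [y_j^-b] according to the sign of
    [b].  A total order on the exponents shows that the torus is a domain in
    which factors of homogeneous elements are homogeneous.  Hence the units of
    [A] are the [c h^al], the image of each [h~_i] is of this form, and the
    images [X], [Y] of [x~_i], [y~_i] are homogeneous of opposite degrees [be],
    [- be] in the [x_j], with [q^(al . be) = q~_i].  If [be_j = - k < 0], the part
    of degree [be] of an element of [A] vanishes at [h_j = q_j^s] for
    [0 <= s < k], hence so does [X Y = (q~_i gamma)^d h^(d al) - 1]; this forces
    [al] to be supported at [j], and [k = 1] because [q~_i^d != 1].  When
    [be_j > 0] the same argument applies to [Y X]. *)
(** * Twisted group algebras *)

Section LinearExtension.
Variables (K : fieldType) (G : choiceType).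
Implicit Types (m : {malg K[G]}).

Definition lext (V : lmodType K) (F : G -> V) m : V :=
  \sum_(k <- msupp m) m@_k *: F k.

Lemma lextEw (V : lmodType K) (F : G -> V) (D : {fset G}) m :
  (msupp m `<=` D)%fset -> lext F m = \sum_(k <- D) m@_k *: F k.
Proof.
move=> le; rewrite /lext [LHS](big_fset_incl _ le) => //= k kD /mcoeff_outdom ->.
by rewrite scale0r.
Qed.

Lemma lext_is_linear (V : lmodType K) (F : G -> V) : linear (lext F).
Proof.
move=> a m1 m2; pose D := (msupp m1 `|` msupp m2 `|` msupp (a *: m1 + m2))%fset.
have le1 : (msupp m1 `<=` D)%fset by rewrite /D -fsetUA fsubsetUl.
have le2 : (msupp m2 `<=` D)%fset by rewrite /D fsetUAC fsubsetUr.
have le3 : (msupp (a *: m1 + m2) `<=` D)%fset by rewrite fsubsetUr.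
rewrite (lextEw F le1) (lextEw F le2) (lextEw F le3).
rewrite scaler_sumr -big_split /=; apply: eq_bigr => k _.
by rewrite mcoeffD mcoeffZ scalerDl scalerA.
Qed.

HB.instance Definition _ (V : lmodType K) (F : G -> V) :=
  GRing.isLinear.Build K {malg K[G]} V *:%R (lext F) (lext_is_linear F).

Lemma lextU (V : lmodType K) (F : G -> V) k : lext F << k >> = F k.
Proof.
by rewrite (@lextEw _ _ [fset k]%fset) ?msuppU_le // big_seq_fset1 mcoeffUU scale1r.
Qed.

Lemma monalgUZ (a : K) (k : G) : << a *g k >> = a *: << k >> :> {malg K[G]}.
Proof. by apply/malgP => k'; rewrite mcoeffZ !mcoeffU mulrnAr mulr1. Qed.

Lemma malgE m : m = \sum_(k <- msupp m) m@_k *: << k >>.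
Proof. by rewrite {1}[m]monalgE; apply: eq_bigr => k _; rewrite monalgUZ. Qed.

Lemma linear_malg_ext (V : lmodType K) (f g : {linear {malg K[G]} -> V}) :
  (forall k, f << k >> = g << k >>) -> f =1 g.
Proof.
move=> fg m; rewrite [m]malgE !linear_sum; apply: eq_bigr => k _.
by rewrite !linearZ /= fg.
Qed.

End LinearExtension.

Record bichar (K : fieldType) (G : zmodType) := Bichar {
  bichar_fun :> G -> G -> K;
  bicharDl : forall g1 g2 g, bichar_fun (g1 + g2) g = bichar_fun g1 g * bichar_fun g2 g;
  bicharDr : forall g g1 g2, bichar_fun g (g1 + g2) = bichar_fun g g1 * bichar_fun g g2;
  bichar_neq0 : forall g1 g2, bichar_fun g1 g2 != 0 }.

Section TwistedAlgebra.
Variables (K : fieldType) (G : zmodType) (c : bichar K G).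

Lemma bichar0l g : c 0 g = 1.
Proof. by apply: (mulfI (bichar_neq0 c 0 g)); rewrite -bicharDl addr0 mulr1. Qed.

Lemma bichar0r g : c g 0 = 1.
Proof. by apply: (mulfI (bichar_neq0 c g 0)); rewrite -bicharDr addr0 mulr1. Qed.

Definition twmul (t1 t2 : {malg K[G]}) : {malg K[G]} :=
  lext (fun g1 => lext (fun g2 => c g1 g2 *: << g1 + g2 >>) t2) t1.

Definition twmulr t2 t1 := twmul t1 t2.

Lemma twmul_linl t2 : linear (twmulr t2).
Proof. by move=> a u v; rewrite /twmulr /twmul linearP. Qed.

Lemma twmul_linr t1 : linear (twmul t1).
Proof.
move=> a u v; rewrite /twmul /lext scaler_sumr -big_split; apply: eq_bigr => k _ /=.
by rewrite -/(lext _ _) linearP scalerDr !scalerA mulrC.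
Qed.

HB.instance Definition _ t := GRing.isLinear.Build K _ _ *:%R (twmulr t) (twmul_linl t).
HB.instance Definition _ t := GRing.isLinear.Build K _ _ *:%R (twmul t) (twmul_linr t).

Lemma twmulZl a t1 t2 : twmul (a *: t1) t2 = a *: twmul t1 t2.
Proof. exact: (linearZ_LR (twmulr t2)). Qed.

Lemma twmulZr a t1 t2 : twmul t1 (a *: t2) = a *: twmul t1 t2.
Proof. exact: linearZ_LR. Qed.

Lemma twmulUU g1 g2 : twmul << g1 >> << g2 >> = c g1 g2 *: << g1 + g2 >>.
Proof. by rewrite /twmul !lextU. Qed.

(** On basis elements this is the cocycle identity, which multiplicativity of [c] in each argument
    provides. The three arguments are reduced to basis elements one at a time by linearity. *)
Lemma twmulA : associative twmul.
Proof.
move=> t1 t2 t3.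
pose F1 := twmulr (twmul t2 t3); pose F2 := twmulr t3 \o twmulr t2.
apply: (@linear_malg_ext _ _ _ F1 F2 _ t1) => g1; rewrite /F1 /F2 /= {t1 F1 F2}.
pose F1 := twmul << g1 >> \o twmulr t3; pose F2 := twmulr t3 \o twmul << g1 >>.
apply: (@linear_malg_ext _ _ _ F1 F2 _ t2) => g2; rewrite /F1 /F2 /= {t2 F1 F2}.
pose F1 := twmul << g1 >> \o twmul << g2 >>; pose F2 := twmul (twmul << g1 >> << g2 >>).
apply: (@linear_malg_ext _ _ _ F1 F2 _ t3) => g3; rewrite /F1 /F2 /= {t3 F1 F2}.
rewrite /twmulr !twmulUU twmulZl twmulZr !twmulUU !scalerA addrA bicharDl bicharDr.
by rewrite [c g2 g3 * _]mulrC mulrA.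
Qed.

Lemma twmul1l : left_id << 0 >> twmul.
Proof.
move=> t; apply: (@linear_malg_ext _ _ _ (twmul << 0 >>) idfun _ t) => g /=.
by rewrite twmulUU bichar0l scale1r add0r.
Qed.

Lemma twmul1r : right_id << 0 >> twmul.
Proof.
move=> t; apply: (@linear_malg_ext _ _ _ (twmulr << 0 >>) idfun _ t) => g /=.
by rewrite /twmulr twmulUU bichar0r scale1r addr0.
Qed.

Lemma twmulDl : left_distributive twmul +%R.
Proof. by move=> t1 t2 t; apply: (linearD (twmulr t)). Qed.

Lemma twmulDr : right_distributive twmul +%R.
Proof. by move=> t t1 t2; apply: linearD. Qed.

Lemma tw1_neq0 : << 0 >> != 0 :> {malg K[G]}.
Proof. by rewrite monalgU_eq0 oner_neq0. Qed.

(** The type remembers [c], so that the ring structure depending on [c] can be inferred and does not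
    clash with the untwisted product of [{malg K[G]}]. *)
Definition rawtw of bichar K G : Type := {malg K[G]}.
HB.instance Definition _ := GRing.Lmodule.on (rawtw c).

HB.instance Definition _ := GRing.Zmodule_isNzRing.Build (rawtw c)
  twmulA twmul1l twmul1r twmulDl twmulDr tw1_neq0.

Lemma twscaleAl (a : K) (t1 t2 : rawtw c) : a *: (t1 * t2) = (a *: t1) * t2.
Proof. by rewrite [in RHS]/GRing.mul /= twmulZl. Qed.

HB.instance Definition _ := GRing.Lmodule_isLalgebra.Build K (rawtw c) twscaleAl.

Lemma twscaleAr (a : K) (t1 t2 : rawtw c) : a *: (t1 * t2) = t1 * (a *: t2).
Proof. by rewrite [in RHS]/GRing.mul /= twmulZr. Qed.

HB.instance Definition _ := GRing.Lalgebra_isAlgebra.Build K (rawtw c) twscaleAr.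

End TwistedAlgebra.

(* The multiplication of [rawtw] unfolds to finitely supported functions;
   hiding it behind an opaque record keeps unification in the algebra fast. *)
Record twisted_algebra (K : fieldType) (G : zmodType) (c : bichar K G) := TwistedAlgebra {
  twalg_of : algType K;
  tmon_of : G -> twalg_of;
  tsupp_of : twalg_of -> {fset G};
  tcoef_of : G -> {linear twalg_of -> K^o};
  tlext_of : forall V : lmodType K, (G -> V) -> {linear twalg_of -> V};
  tcoefU_of : forall k g, tcoef_of k (tmon_of g) = (g == k)%:R;
  in_tsupp_of : forall k t, (k \in tsupp_of t) = (tcoef_of k t != 0);
  twalgE_of : forall t, t = \sum_(k <- tsupp_of t) tcoef_of k t *: tmon_of k;
  tlextU_of : forall (V : lmodType K) (F : G -> V) g, tlext_of F (tmon_of g) = F g;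
  tmonM_of : forall g1 g2, tmon_of g1 * tmon_of g2 = c g1 g2 *: tmon_of (g1 + g2);
  tmon0_of : tmon_of 0 = 1 }.

Section OpaqueTwistedAlgebra.
Variables (K : fieldType) (G : zmodType) (c : bichar K G).

Let rawcoef (k : G) (t : rawtw c) : K^o := mcoeff k t.
Let rawcoef_linear k : linear (rawcoef k).
Proof. by move=> a u v; rewrite /rawcoef mcoeffD mcoeffZ. Qed.
HB.instance Definition _ k := GRing.isLinear.Build K _ _ *:%R (rawcoef k) (rawcoef_linear k).

Let rawlext (V : lmodType K) (F : G -> V) : rawtw c -> V := lext F.
Let rawlext_linear (V : lmodType K) (F : G -> V) : linear (rawlext F).
Proof. exact: lext_is_linear. Qed.
HB.instance Definition _ V F :=
  GRing.isLinear.Build K _ _ *:%R (@rawlext V F) (@rawlext_linear V F).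

Lemma twisted_algebra_exists : twisted_algebra c.
Proof.
apply: (@TwistedAlgebra K G c (rawtw c) (fun g => << g >>) (fun t => msupp t)
  rawcoef rawlext) => //=.
- by move=> k g; rewrite /rawcoef mcoeffU.
- by move=> k t; rewrite mcoeff_neq0.
- exact: malgE.
- by move=> V F g; rewrite /rawlext lextU.
- exact: twmulUU.
Qed.

Definition twalg : algType K := twalg_of twisted_algebra_exists.
Definition tmon : G -> twalg := @tmon_of _ _ _ twisted_algebra_exists.
Definition tsupp : twalg -> {fset G} := @tsupp_of _ _ _ twisted_algebra_exists.
Definition tcoef : G -> {linear twalg -> K^o} := @tcoef_of _ _ _ twisted_algebra_exists.
Definition tlext (V : lmodType K) (F : G -> V) : {linear twalg -> V} := tlext_of _ F.
Implicit Type t : twalg.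

Lemma tcoefU k g : tcoef k (tmon g) = (g == k)%:R.
Proof. exact: tcoefU_of. Qed.

Lemma tcoefZ k a t : tcoef k (a *: t) = a * tcoef k t.
Proof. exact: linearZ. Qed.

Lemma in_tsupp k t : (k \in tsupp t) = (tcoef k t != 0).
Proof. exact: in_tsupp_of. Qed.

Lemma twalgE t : t = \sum_(k <- tsupp t) tcoef k t *: tmon k.
Proof. exact: twalgE_of. Qed.

Lemma tlextU (V : lmodType K) (F : G -> V) g : tlext F (tmon g) = F g.
Proof. exact: tlextU_of. Qed.

Lemma tmonM g1 g2 : tmon g1 * tmon g2 = c g1 g2 *: tmon (g1 + g2).
Proof. exact: tmonM_of. Qed.

Lemma tmon0 : tmon 0 = 1. Proof. exact: tmon0_of. Qed.

Lemma twalg_linear_ext (V : lmodType K) (f1 f2 : {linear twalg -> V}) :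
  (forall g, f1 (tmon g) = f2 (tmon g)) -> f1 =1 f2.
Proof.
move=> f12 t; rewrite [t]twalgE !linear_sum; apply: eq_bigr => g _.
by rewrite !linearZ /= f12.
Qed.

Definition tlmul (w : twalg) t := w * t.
Lemma tlmul_linear w : linear (tlmul w).
Proof. by move=> a u v; rewrite /tlmul mulrDr scalerAr. Qed.
HB.instance Definition _ w := GRing.isLinear.Build K _ _ *:%R (tlmul w) (tlmul_linear w).

Definition trmul (w : twalg) t := t * w.
Lemma trmul_linear w : linear (trmul w).
Proof. by move=> a u v; rewrite /trmul mulrDl scalerAl. Qed.
HB.instance Definition _ w := GRing.isLinear.Build K _ _ *:%R (trmul w) (trmul_linear w).

Lemma tsupp_eq0 t : tsupp t = fset0 -> t = 0.
Proof. by move=> t0; rewrite [t]twalgE t0 big_seq_fset0. Qed.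

Lemma tcoefUM k g t : tcoef k (tmon g * t) = c g (k - g) * tcoef (k - g) t.
Proof.
rewrite {1}[t]twalgE mulr_sumr linear_sum /= [X in _ * tcoef _ X]twalgE.
rewrite [tcoef (k - g) _]linear_sum mulr_sumr; apply: eq_bigr => g' _ /=.
rewrite -scalerAr tmonM scalerA !tcoefZ !tcoefU [_ == k]eq_sym [g + g']addrC -[k == _]subr_eq.
rewrite [g' == _]eq_sym; case: eqP => [->|_]; last by rewrite !mulr0.
by rewrite !mulr1 mulrC.
Qed.

Lemma tcoefM k t1 t2 :
  tcoef k (t1 * t2) = \sum_(g <- tsupp t1) tcoef g t1 * (c g (k - g) * tcoef (k - g) t2).
Proof.
rewrite {1}[t1]twalgE mulr_suml linear_sum; apply: eq_bigr => g _ /=.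
by rewrite -scalerAl /= tcoefZ tcoefUM.
Qed.

End OpaqueTwistedAlgebra.
Arguments tcoef {K G c} k.
Arguments tlext {K G c V} F.

(** * Lexicographic orders on the exponents and leading monomials *)

Section OrderedSupport.
Variables (K : fieldType) (G : zmodType) (c : bichar K G).
Implicit Types (g : G) (t : twalg c).

(** The positive cone of a lexicographic preorder. The list of functionals is a parameter so that a
    chosen functional can be put in front of it. *)
Fixpoint lexpos (ls : seq {additive G -> int}) (g : G) : bool :=
  if ls is l :: ls' then (0 < l g) || ((l g == 0) && lexpos ls' g) else false.

Lemma lexposD ls g1 g2 : lexpos ls g1 -> lexpos ls g2 -> lexpos ls (g1 + g2).
Proof.
elim: ls => //= l ls IH; rewrite raddfD.
move=> /orP[h1|/andP[/eqP-> h1]] /orP[h2|/andP[/eqP-> h2]].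
- by rewrite addr_gt0.
- by rewrite addr0 h1.
- by rewrite add0r h2.
- by rewrite addr0 eqxx IH ?orbT.
Qed.

Lemma lexpos0 ls : lexpos ls 0 = false.
Proof. by elim: ls => //= l ls ->; rewrite raddf0 ltxx andbF. Qed.

Lemma lexpos_total ls g : ~~ all (fun l : {additive G -> int} => l g == 0) ls -> lexpos ls g || lexpos ls (- g).
Proof.
elim: ls => //= l ls IH; rewrite negb_and raddfN oppr_eq0 oppr_gt0.
by have [//|//|/=] := ltgtP (l g) 0; rewrite ?orbT.
Qed.

(** Under this condition the preorder becomes a total order compatible with addition. *)
Definition separating (ls : seq {additive G -> int}) :=
  forall g, all (fun l : {additive G -> int} => l g == 0) ls -> g = 0.

Lemma seq_lexmax ls (s : seq G) : separating ls -> s != [::] ->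
  exists2 M, M \in s & forall g, g \in s -> g != M -> lexpos ls (M - g).
Proof.
move=> sep; elim: s => // g0 s IH _; have [->|/IH[M Ms HM]] := eqVneq s [::].
  by exists g0 => [|g]; rewrite inE // => /eqP->; rewrite eqxx.
have [->|ne] := eqVneq g0 M.
  exists M => [|g]; rewrite inE ?eqxx // => /orP[/eqP->|/HM//]; first by rewrite eqxx.
have /lexpos_total/orP[pos|] : ~~ all (fun l : {additive G -> int} => l (M - g0) == 0) ls.
  by apply: contra ne => /sep/subr0_eq ->.
  by exists M => [|g]; rewrite inE ?Ms ?orbT // => /orP[/eqP->|/HM].
rewrite opprB => pos; exists g0 => [|g]; rewrite inE ?eqxx //.
case/orP=> [/eqP->|gs _]; first by rewrite eqxx.
have [->//|gM] := eqVneq g M.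
by rewrite -(subrKA M) lexposD // HM.
Qed.

Definition lexmax ls t M :=
  M \in tsupp t /\ forall g, g \in tsupp t -> g != M -> lexpos ls (M - g).

(** Any other pair of exponents with sum [M1 + M2] would give two positive elements [M1 - g] and
    [M2 - g'] with sum 0. *)
Lemma tcoefM_lexmax ls t1 t2 M1 M2 : lexmax ls t1 M1 -> lexmax ls t2 M2 ->
  tcoef (M1 + M2) (t1 * t2) = c M1 M2 * (tcoef M1 t1 * tcoef M2 t2).
Proof.
move=> [s1 h1] [s2 h2]; rewrite tcoefM (big_fsetD1 M1) //= big_seq big1 ?addr0.
  by rewrite mulrCA addrAC subrr add0r.
move=> g; rewrite !inE => /andP[gM /h1/(_ gM) pos].
case E: (M1 + M2 - g \in tsupp t2); last first.
  by move/negbT: E; rewrite in_tsupp negbK => /eqP->; rewrite !mulr0.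
have ne : M1 + M2 - g != M2.
  by apply: contraNneq gM => /eqP; rewrite addrAC -subr_eq0 addrK subr_eq0 eq_sym.
have := lexposD pos (h2 _ E ne).
by rewrite [M1 + M2]addrC -[M2 + M1 - g]addrA [- (M2 + _)]opprD addNKr subrr lexpos0.
Qed.

Lemma lexmax_exists ls t : separating ls -> t != 0 -> exists M, lexmax ls t M.
Proof.
move=> sep nz; have [|M sM hM] := @seq_lexmax ls (tsupp t) sep; last by exists M.
apply: contra nz => /eqP t0.
apply/eqP/tsupp_eq0/fsetP => g; rewrite in_fset0; apply/negP => gt.
by have : g \in (tsupp t : seq G) by []; rewrite t0.
Qed.

Lemma twalg_mul_neq0 ls t1 t2 : separating ls -> t1 != 0 -> t2 != 0 -> t1 * t2 != 0.
Proof.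
move=> sep /(lexmax_exists sep)[M1 h1] /(lexmax_exists sep)[M2 h2].
apply/eqP => t0; have /esym/eqP := tcoefM_lexmax h1 h2; rewrite t0 linear0.
by apply/negP; rewrite !mulf_neq0 ?bichar_neq0 -?in_tsupp ?h1.1 ?h2.1.
Qed.

(** Comparing leading coefficients on both sides turns a commutation rule between arbitrary elements
    into one between two monomials that occur in them. *)
Lemma bichar_of_qcomm ls t1 t2 (k : K) : separating ls -> t1 != 0 -> t2 != 0 ->
  t1 * t2 = k *: (t2 * t1) ->
  exists g1 g2, [/\ g1 \in tsupp t1, g2 \in tsupp t2 & c g1 g2 = k * c g2 g1].
Proof.
move=> sep /(lexmax_exists sep)[M1 h1] /(lexmax_exists sep)[M2 h2] E.
exists M1, M2; split; [exact: h1.1|exact: h2.1|].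
apply: (@mulIf _ (tcoef M1 t1 * tcoef M2 t2)).
  by rewrite mulf_neq0 // -in_tsupp ?h1.1 ?h2.1.
rewrite -(tcoefM_lexmax h1 h2) E tcoefZ [M1 + M2]addrC (tcoefM_lexmax h2 h1).
by rewrite [tcoef M2 _ * _]mulrC mulrA.
Qed.

(** With [l] as first functional the leading exponents maximize [l], with [- l] they minimize it. In
    both cases the leading exponents add up to an exponent of the product, so the two maxima and the
    two minima of [l] both have sum [k], which leaves no room in between. *)
Lemma homog_factors ls (l : {additive G -> int}) t1 t2 (k : int) :
    separating ls -> t1 != 0 -> t2 != 0 ->
    (forall g, g \in tsupp (t1 * t2) -> l g = k) ->
  forall g1 g2, g1 \in tsupp t1 -> g2 \in tsupp t2 -> l g1 + l g2 = k.
Proof.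
move=> sep nz1 nz2 hl.
have inM ls' M1 M2 : lexmax ls' t1 M1 -> lexmax ls' t2 M2 -> l M1 + l M2 = k.
  move=> h1 h2; rewrite -raddfD; apply: hl.
  by rewrite in_tsupp (tcoefM_lexmax h1 h2) !mulf_neq0 ?bichar_neq0 -?in_tsupp ?h1.1 ?h2.1.
pose l' : {additive G -> int} := \- l.
have sepu : separating (l :: ls) by move=> g /= /andP[_ /sep].
have sepd : separating (l' :: ls) by move=> g /= /andP[_ /sep].
have [M1 h1] := lexmax_exists sepu nz1; have [M2 h2] := lexmax_exists sepu nz2.
have [m1 d1] := lexmax_exists sepd nz1; have [m2 d2] := lexmax_exists sepd nz2.
have le (lam : {additive G -> int}) t M g :
    lexmax (lam :: ls) t M -> g \in tsupp t -> lam g <= lam M.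
  have [->//|ne [_ h] /h/(_ ne)/=] := eqVneq g M; rewrite raddfB subr_gt0 subr_eq0.
  by move=> /orP[/ltW//|/andP[/eqP->]].
move=> g1 g2 G1 G2; apply/eqP; rewrite eq_le -{1}(inM _ _ _ h1 h2) -(inM _ _ _ d1 d2).
apply/andP; split; apply: lerD; first exact: le h1 G1; first exact: le h2 G2.
  by rewrite -lerN2; exact: (le l' _ _ _ d1 G1).
by rewrite -lerN2; exact: (le l' _ _ _ d2 G2).
Qed.

End OrderedSupport.

(** * Subalgebras containing the generators *)

Lemma rmorph_a_d (A B : pzRingType) (f : {rmorphism A -> B}) d X :
  f (a_d d X) = a_d d (f X).
Proof. by rewrite /a_d rmorphB rmorphXn rmorph1. Qed.

Section Subalgebra.
Variables (K : fieldType) (A : algType K) (S : {pred A}).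
Hypothesis S_subalg : subalg_closed S.

Definition subalg of subalg_closed S : Type := {a : A | a \in S}.
HB.instance Definition _ := [isSub of subalg S_subalg for @sval A (fun a => a \in S)].
HB.instance Definition _ := [Choice of subalg S_subalg by <:].
HB.instance Definition _ :=
  GRing.SubChoice_isSubAlgebra.Build K A _ (subalg S_subalg) S_subalg.
Definition subalg_val (u : subalg S_subalg) : A := val u.
Lemma subalg_val_linear : linear subalg_val.
Proof. by []. Qed.
Lemma subalg_val_monoid : monoid_morphism subalg_val.
Proof. by []. Qed.
HB.instance Definition _ := GRing.isLinear.Build K _ _ *:%R subalg_val subalg_val_linear.
HB.instance Definition _ := GRing.isMonoidMorphism.Build _ _ subalg_val subalg_val_monoid.


End Subalgebra.

Section GeneratorInduction.
Variables (K : fieldType) (n d : nat) (q : 'I_n -> K) (A : algType K).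
Variables (x y h hi : 'I_n -> A).
Hypothesis HA : is_A_presentation d q x y h hi.

(** The generators satisfy the relations inside the subalgebra [S], so the universal property gives
    a map from [A] to [S]. Followed by the inclusion it fixes the generators, hence is the identity
    by uniqueness. *)
Lemma mem_subalg_gen (S : {pred A}) : subalg_closed S ->
  (forall i, [/\ x i \in S, y i \in S, h i \in S & hi i \in S]) -> forall a, a \in S.
Proof.
move=> Ssub Sgen a.
have Sx i : x i \in S by case: (Sgen i).
have Sy i : y i \in S by case: (Sgen i).
have Sh i : h i \in S by case: (Sgen i).
have Shi i : hi i \in S by case: (Sgen i).
pose B : algType K := subalg Ssub.
pose xB i : B := exist (fun a => a \in S) _ (Sx i); pose yB i : B := exist (fun a => a \in S) _ (Sy i).
pose hB i : B := exist (fun a => a \in S) _ (Sh i); pose hiB i : B := exist (fun a => a \in S) _ (Shi i).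
pose vS : {lrmorphism B -> A} := @subalg_val K A S Ssub; have v_inj : injective vS := val_inj.
have [[rels1 rels2] univ] := HA.
have BB : GWA_rels d q xB yB hB hiB.
  split=> [i|i j ij u v].
    have [[e1 e2] e3 e4 e5 e6] := rels1 i.
    split; [split| | | |]; apply: v_inj.
    - by rewrite rmorphM rmorph1 /=.
    - by rewrite rmorphM rmorph1 /=.
    - by rewrite linearZ !rmorphM /=.
    - by rewrite linearZ !rmorphM /=.
    - by rewrite rmorphM rmorph_a_d /= linearZ.
    - by rewrite rmorphM rmorph_a_d /=.
  move=> us vs; apply: v_inj; rewrite !rmorphM; apply: (rels2 i j ij).
    by move: us; rewrite !inE => /or4P[]/eqP->; rewrite eqxx ?orbT.
  by move: vs; rewrite !inE => /or4P[]/eqP->; rewrite eqxx ?orbT.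
have [[f fE] _] := univ B xB yB hB hiB BB.
have [_ uniq] := univ A x y h hi (HA.1).
have := uniq (@subalg_val K A S Ssub \o f) idfun.
move=> E; rewrite -[a]/(idfun a) -E => [|i|i]; first exact: valP.
  by have [/= -> -> -> ->] := fE i.
by [].
Qed.

(** [P] itself is not assumed stable under products; the elements whose left multiplication
    preserves [P] form a subalgebra containing the generators, and this subalgebra is then applied
    to 1. *)
Lemma gen_ind (P : A -> Prop) : P 1 ->
  (forall a u v, P u -> P v -> P (a *: u + v)) ->
  (forall i u, P u -> [/\ P (x i * u), P (y i * u), P (h i * u) & P (hi i * u)]) ->
  forall a, P a.
Proof.
move=> P1 Plin Pgen a.
have P0 : P 0 by rewrite -[0](addNr 1) -scaleN1r; exact: Plin.
pose S : {pred A} := [pred a | `[< forall u, P u -> P (a * u) >]].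
have Ssub : subalg_closed S.
  split; first by apply/asboolP => u; rewrite mul1r.
    move=> c u v /asboolP hu /asboolP hv; apply/asboolP => w hw.
    by rewrite mulrDl -scalerAl; apply: Plin; [exact: hu|exact: hv].
  move=> u v /asboolP hu /asboolP hv; apply/asboolP => w hw.
  by rewrite -mulrA; apply: hu; exact: hv.
have Sgen i : [/\ x i \in S, y i \in S, h i \in S & hi i \in S].
  by split; apply/asboolP => u /(Pgen i)[].
by rewrite -[a]mulr1; move/asboolP: (mem_subalg_gen Ssub Sgen a); apply.
Qed.

End GeneratorInduction.

(** * The quantum torus *)

Lemma qcomm_a_d (K : fieldType) (B : algType K) (k : K) (u v : B) d :
  u * v = k *: (v * u) -> u * a_d d v = a_d d (k *: v) * u.
Proof.
move=> E; rewrite /a_d mulrBr mulrBl mulr1 mul1r; congr (_ - _).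
elim: d => [|d IH]; first by rewrite !expr0 mulr1 mul1r.
by rewrite !exprS mulrA E -mulrA -scalerAl -mulrA IH scalerAl mulrA.
Qed.

Section QuantumTorus.
Variables (K : fieldType) (n : nat) (q : 'I_n -> K).
Hypothesis hq0 : forall i, q i != 0.

Definition lattice : zmodType := ({ffun 'I_n -> int} * {ffun 'I_n -> int})%type.
Implicit Types (g : lattice) (i j : 'I_n).

(** A pair [(a, b)] stands for [h^a x^b] in this order. The factor is the cost of moving the
    [x]-part of [g1] to the right of the [h]-part of [g2]. *)
Definition qpair (g1 g2 : lattice) : K := \prod_j q j ^ (g1.2 j * g2.1 j).

Lemma qpairDl g1 g2 g : qpair (g1 + g2) g = qpair g1 g * qpair g2 g.
Proof. by rewrite -big_split; apply: eq_bigr => j _; rewrite ffunE mulrDl expfzDr. Qed.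

Lemma qpairDr g g1 g2 : qpair g (g1 + g2) = qpair g g1 * qpair g g2.
Proof. by rewrite -big_split; apply: eq_bigr => j _; rewrite ffunE mulrDr expfzDr. Qed.

Lemma qpair_neq0 g1 g2 : qpair g1 g2 != 0.
Proof. by apply/prodf_neq0 => j _; rewrite expfz_neq0. Qed.

Definition qbichar := Bichar qpairDl qpairDr qpair_neq0.
Definition qtorus : algType K := twalg qbichar.

Notation U g := (tmon qbichar (g : lattice)).

Definition dl j (z : int) : {ffun 'I_n -> int} := [ffun i => if i == j then z else 0].

Lemma dlD j z1 z2 : dl j z1 + dl j z2 = dl j (z1 + z2).
Proof. by apply/ffunP => i; rewrite !ffunE; case: eqP; rewrite ?addr0. Qed.

Lemma dl0 j : dl j 0 = 0.
Proof. by apply/ffunP => i; rewrite !ffunE if_same. Qed.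

Lemma qpair_dl j z (a : {ffun 'I_n -> int}) g : qpair (a, dl j z) g = q j ^ (z * g.1 j).
Proof.
rewrite /qpair (bigD1 j) //= ffunE eqxx big1 ?mulr1 // => i /negPf ij.
by rewrite ffunE ij mul0r expr0z.
Qed.

Lemma qpair_dr j z (b : {ffun 'I_n -> int}) g : qpair g (dl j z, b) = q j ^ (g.2 j * z).
Proof.
rewrite /qpair (bigD1 j) //= ffunE eqxx big1 ?mulr1 // => i /negPf ij.
by rewrite ffunE ij mulr0 expr0z.
Qed.

Lemma qpair0l (a : {ffun 'I_n -> int}) g : qpair (a, 0) g = 1.
Proof. by apply: big1 => j _; rewrite ffunE mul0r expr0z. Qed.

Lemma qpair0r (b : {ffun 'I_n -> int}) g : qpair g (0, b) = 1.
Proof. by apply: big1 => j _; rewrite ffunE mulr0 expr0z. Qed.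

Lemma UM g1 g2 : U g1 * U g2 = qpair g1 g2 *: U (g1 + g2).
Proof. exact: tmonM. Qed.

Lemma U_comm g1 g2 : (forall i, g1.2 i = 0 \/ g2.1 i = 0) ->
  (forall i, g2.2 i = 0 \/ g1.1 i = 0) -> U g1 * U g2 = U g2 * U g1.
Proof.
move=> h12 h21; rewrite !UM addrC; congr (_ *: _); rewrite /qpair !big1 // => i _.
  by case: (h21 i) => ->; rewrite ?mulr0 ?mul0r expr0z.
by case: (h12 i) => ->; rewrite ?mulr0 ?mul0r expr0z.
Qed.

Definition hT j : qtorus := U (dl j 1, 0).
Definition hiT j : qtorus := U (dl j (-1), 0).
Definition xT j : qtorus := U (0, dl j 1).
Definition xiT j : qtorus := U (0, dl j (-1)).
Definition yT d j : qtorus := a_d d (hT j) * xiT j.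

Lemma U_eq1 g : g = 0 -> U g = 1.
Proof. by move->; exact: tmon0. Qed.

Lemma hT_inv j : hT j * hiT j = 1 /\ hiT j * hT j = 1.
Proof.
by split; rewrite UM qpair0l scale1r U_eq1 //; congr pair; rewrite ?addr0 // dlD dl0.
Qed.

Lemma xT_inv j : xT j * xiT j = 1 /\ xiT j * xT j = 1.
Proof.
by split; rewrite UM qpair0r scale1r U_eq1 //; congr pair; rewrite ?addr0 // dlD dl0.
Qed.

Lemma qcommT j z : U (0, dl j z) * hT j = (q j ^ z) *: (hT j * U (0, dl j z)).
Proof.
by rewrite !UM qpair_dl /= ffunE eqxx mulr1 qpair0l scale1r [in RHS]addrC.
Qed.

Lemma qtorus_rels d : GWA_rels d q xT (yT d) hT hiT.
Proof.
split=> [i|i j ij u v].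
  split; first exact: hT_inv.
  - by rewrite /xT qcommT expr1z.
  - rewrite /yT -mulrA /xiT qcommT -scalerAr !mulrA exprN1 /a_d mulrBr mulrBl mulr1 mul1r.
    by rewrite -exprS -exprSr.
  - rewrite /yT mulrA (@qcomm_a_d _ _ (q i)) ?/xT ?qcommT ?expr1z //.
    by rewrite -mulrA (xT_inv i).1 mulr1.
  - by rewrite /yT -mulrA (xT_inv i).2 mulr1.
(* Since [yT] is not a monomial, commutation is settled first among monomials, then with [yT] on one
   side, and finally on both. *)
have comm0 u' v' : u' \in [:: hT i; hiT i; xT i; xiT i] ->
    v' \in [:: hT j; hiT j; xT j; xiT j] -> GRing.comm u' v'.
  rewrite !inE => /or4P[]/eqP-> /or4P[]/eqP->; apply: U_comm => k /=; rewrite !ffunE;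
  by have [ki|_] := eqVneq k i; rewrite ?ki ?(negPf ij); auto.
have comm1 u' v' : u' \in [:: hT i; hiT i; xT i; xiT i] ->
    v' \in [:: hT j; hiT j; xT j; yT d j] -> GRing.comm u' v'.
  move=> hu'; rewrite !inE => /or4P[]/eqP->; rewrite /yT /a_d; last apply: commrM;
    try by apply: (comm0 _ _ hu'); rewrite ?inE ?eqxx ?orbT.
  by apply: commrB; [apply: commrX; apply: (comm0 _ _ hu'); rewrite ?inE ?eqxx ?orbT | exact: commr1].
move=> hu hv; move: hu; rewrite !inE => /or4P[]/eqP->;
  try by apply: comm1 hv; rewrite ?inE ?eqxx ?orbT.
apply: commr_sym; rewrite /yT /a_d; apply: commrM; last first.
  by apply: commr_sym; apply: comm1 hv; rewrite ?inE ?eqxx ?orbT.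
apply: commrB; last exact: commr1.
by apply/commrX/commr_sym; apply: comm1 hv; rewrite ?inE ?eqxx ?orbT.
Qed.

(** * Evaluation of homogeneous components at powers of [q_j] *)

Definition clr j g : lattice := ([ffun i => if i == j then 0 else g.1 i], g.2).

(* Evaluation at [h_j = q_j ^ s] of the component of degree [- k] in [x_j]. *)
Definition evT j (k s : int) : {linear qtorus -> qtorus} :=
  tlext (fun g : lattice => if g.2 j == - k then q j ^ (s * g.1 j) *: U (clr j g) else 0).

Lemma evTU j k s g :
  evT j k s (U g) = if g.2 j == - k then q j ^ (s * g.1 j) *: U (clr j g) else 0.
Proof. exact: tlextU. Qed.

Lemma evT_Ul j k s g0 (t : qtorus) : g0.1 j = 0 -> g0.2 j = 0 ->
  evT j k s (U g0 * t) = U g0 * evT j k s t.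
Proof.
move=> g01 g02.
pose f1 : {linear qtorus -> qtorus} := evT j k s \o tlmul (U g0).
pose f2 : {linear qtorus -> qtorus} := tlmul (U g0) \o evT j k s.
apply: (@twalg_linear_ext _ _ _ _ f1 f2 _ t) => g /=; rewrite /tlmul /trmul.
rewrite UM linearZ /= !evTU /= !ffunE g01 g02 !add0r; case: eqP => _; last by rewrite scaler0 mulr0.
rewrite -scalerAr UM !scalerA mulrC; congr (_ * _ *: U _).
  apply: eq_bigr => i _ /=; rewrite ffunE; case: eqP => [->|//].
  by rewrite g02 !mul0r.
by congr pair; apply/ffunP => i; rewrite !ffunE; case: eqP => [->|//]; rewrite g01 addr0.
Qed.

Lemma evT_hl j k s z (t : qtorus) :
  evT j k s (U (dl j z, 0) * t) = q j ^ (s * z) *: evT j k s t.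
Proof.
pose f1 : {linear qtorus -> qtorus} := evT j k s \o tlmul (U (dl j z, 0)).
pose f2 : {linear qtorus -> qtorus} := q j ^ (s * z) \*: evT j k s.
apply: (@twalg_linear_ext _ _ _ _ f1 f2 _ t) => g /=; rewrite /tlmul /trmul.
rewrite UM qpair0l scale1r !evTU /= !ffunE eqxx add0r; case: eqP => _; last by rewrite scaler0.
rewrite scalerA -expfzDr // -mulrDr; congr (_ *: U _).
by congr pair; apply/ffunP => i; rewrite !ffunE; [case: eqP => // _|]; rewrite add0r.
Qed.

(** Bringing [x_j^z] past [h_j^a] costs [q_j^(z a)], which moves the evaluation point by [z],
    together with the degree. The difference between [k] and [s] is therefore preserved. *)
Lemma evT_xl j k s z (t : qtorus) :
  evT j k s (U (0, dl j z) * t) = U (0, dl j z) * evT j (k + z) (s + z) t.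
Proof.
pose f1 : {linear qtorus -> qtorus} := evT j k s \o tlmul (U (0, dl j z)).
pose f2 : {linear qtorus -> qtorus} := tlmul (U (0, dl j z)) \o evT j (k + z) (s + z).
apply: (@twalg_linear_ext _ _ _ _ f1 f2 _ t) => g /=; rewrite /tlmul /trmul.
rewrite UM qpair_dl linearZ /= !evTU /= !ffunE eqxx.
have -> : (z + g.2 j == - k) = (g.2 j == - (k + z)).
  by rewrite opprD eq_sym [RHS]eq_sym subr_eq addrC.
case: eqP => _; last by rewrite scaler0 mulr0.
rewrite -scalerAr UM qpair_dl /= ffunE eqxx mulr0 expr0z scale1r scalerA -expfzDr //.
rewrite add0r -mulrDl [z + s]addrC; congr (_ *: U _).
by congr pair; apply/ffunP => i; rewrite !ffunE; case: eqP => // _; rewrite add0r.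
Qed.

(** Unlike multiplication by [x_j^z] on the left, multiplication on the right shifts the degree but
    not the evaluation point, because the [h]-part of [t] already stands to the left of [g']. The
    scalar collects the value of the [h_j]-part of [g'] and its passage through the [x_j]-part of
    [t]. *)
Lemma evT_Ur j k s g' (t : qtorus) :
  evT j k s (t * U g') =
    q j ^ ((s - (k + g'.2 j)) * g'.1 j) *: (evT j (k + g'.2 j) s t * U (clr j g')).
Proof.
set z := q j ^ _.
pose f1 : {linear qtorus -> qtorus} := evT j k s \o trmul (U g').
pose f2 : {linear qtorus -> qtorus} := z \*: (trmul (U (clr j g')) \o evT j (k + g'.2 j) s).
apply: (@twalg_linear_ext _ _ _ _ f1 f2 _ t) => g /=; rewrite /tlmul /trmul.
rewrite UM linearZ /= !evTU /= !ffunE.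
have -> : (g.2 j + g'.2 j == - k) = (g.2 j == - (k + g'.2 j)).
  by rewrite opprD eq_sym [RHS]eq_sym subr_eq.
case: eqP => [gk|_]; last by rewrite scaler0 mul0r scaler0.
rewrite -scalerAl UM !scalerA.
have -> : qpair g g' = q j ^ (g.2 j * g'.1 j) * qpair (clr j g) (clr j g').
  rewrite /qpair (bigD1 j) //= [in RHS](bigD1 j) //= ffunE eqxx mulr0 expr0z mul1r.
  by congr (_ * _); apply: eq_bigr => i /negPf ij; rewrite ffunE ij.
congr (_ *: U _).
  by rewrite /z -gk mulrDr mulrDl !expfzDr //; ring.
by congr pair; apply/ffunP => i; rewrite !ffunE; case: eqP => // _; rewrite addr0.
Qed.

Lemma hTX j m : hT j ^+ m = U (dl j m%:Z, 0).
Proof.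
elim: m => [|m IH]; first by rewrite dl0 U_eq1.
by rewrite exprS IH UM qpair0l scale1r; congr (U (pair _ _)); rewrite ?addr0 // dlD -intS.
Qed.

Lemma evT_adl j k s d (t : qtorus) :
  evT j k s (a_d d (hT j) * t) = (q j ^ (s * d%:Z) - 1) *: evT j k s t.
Proof. by rewrite /a_d mulrBl mul1r linearB /= hTX evT_hl scalerBl scale1r. Qed.

Lemma evT_adl_neq i j k s d (t : qtorus) : i != j ->
  evT j k s (a_d d (hT i) * t) = a_d d (hT i) * evT j k s t.
Proof.
move=> /negPf ij.
by rewrite /a_d !mulrBl !mul1r linearB /= hTX evT_Ul //= ffunE // eq_sym ij.
Qed.

Lemma hexp_additive j : additive (fun g : lattice => g.1 j).
Proof. by move=> u v; rewrite !ffunE. Qed.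
Definition hexp j (g : lattice) : int := g.1 j.
HB.instance Definition _ j := GRing.isZmodMorphism.Build lattice int (hexp j) (hexp_additive j).

Lemma xexp_additive j : additive (fun g : lattice => g.2 j).
Proof. by move=> u v; rewrite !ffunE. Qed.
Definition xexp j (g : lattice) : int := g.2 j.
HB.instance Definition _ j := GRing.isZmodMorphism.Build lattice int (xexp j) (xexp_additive j).

Definition coords : seq {additive lattice -> int} :=
  [seq (hexp j : {additive lattice -> int}) | j <- enum 'I_n] ++
  [seq (xexp j : {additive lattice -> int}) | j <- enum 'I_n].

Lemma coords_sep : separating coords.
Proof.
move=> [a b]; rewrite all_cat !all_map => /andP[/allP ha /allP hb].
congr pair; apply/ffunP => j; rewrite ffunE; apply/eqP.
  by have := ha j; rewrite -enumT mem_enum; apply.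
by have := hb j; rewrite -enumT mem_enum; apply.
Qed.

Lemma qtorus_mul_neq0 (t1 t2 : qtorus) : t1 != 0 -> t2 != 0 -> t1 * t2 != 0.
Proof. exact: (twalg_mul_neq0 coords_sep). Qed.

End QuantumTorus.

(** * Normal forms *)

Lemma tsuppM (K : fieldType) (G : zmodType) (c : bichar K G) (t1 t2 : twalg c) k :
  k \in tsupp (t1 * t2) -> exists g1 g2, [/\ g1 \in tsupp t1, g2 \in tsupp t2 & k = g1 + g2].
Proof.
rewrite in_tsupp => nz; apply: contrapT => H; move/eqP: nz; apply.
rewrite tcoefM big_seq big1 // => g gt; have [gk|] := boolP (k - g \in tsupp t2).
  by case: H; exists g, (k - g); split; rewrite ?[g + _]addrC ?subrK.
by rewrite in_tsupp negbK => /eqP->; rewrite !mulr0.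
Qed.

Section Zpow.
Variables (K : fieldType) (A : algType K).
Implicit Types (u v h hi : A).

Lemma PoszS (m : nat) : m%:Z + 1 = m.+1%:Z. Proof. lia. Qed.
Lemma PoszK (m : nat) : m.+1%:Z - 1 = m%:Z. Proof. lia. Qed.
Lemma NegzS (m : nat) : Negz m.+1 + 1 = Negz m. Proof. lia. Qed.
Lemma NegzP (m : nat) : Negz m - 1 = Negz m.+1. Proof. lia. Qed.

Lemma zpowS h hi z : h * hi = 1 -> zpow h hi (z + 1) = h * zpow h hi z.
Proof.
move=> hK; case: z => [m|[|m]]; first by rewrite PoszS /= exprS.
  by rewrite /= expr0 expr1 hK.
by rewrite NegzS /= [in RHS]exprS mulrA hK mul1r.
Qed.

Lemma zpowP h hi z : hi * h = 1 -> zpow h hi (z - 1) = hi * zpow h hi z.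
Proof.
move=> hK; case: z => [[|m]|m]; first by rewrite /= expr0 expr1 mulr1.
  by rewrite PoszK /= exprS mulrA hK mul1r.
by rewrite NegzP /= -exprS.
Qed.

Lemma zpow_ind (P : int -> Prop) : P 0 -> (forall z, P z -> P (z + 1)) ->
  (forall z, P z -> P (z - 1)) -> forall z, P z.
Proof.
move=> P0 PS PP [m|m]; first by elim: m => // m /PS; rewrite PoszS.
by elim: m => [|m /PP]; [exact: (PP 0) | rewrite NegzP].
Qed.

Lemma zpowD h hi z1 z2 : h * hi = 1 -> hi * h = 1 ->
  zpow h hi (z1 + z2) = zpow h hi z1 * zpow h hi z2.
Proof.
move=> e1 e2; elim/zpow_ind: z1 => [|z IH|z IH]; first by rewrite add0r /= expr0 mul1r.
  by rewrite addrAC !zpowS // IH mulrA.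
by rewrite addrAC !zpowP // IH mulrA.
Qed.

Lemma qcomm_zpow h hi u (k : K) z : h * hi = 1 -> hi * h = 1 -> k != 0 ->
  u * h = k *: (h * u) -> u * zpow h hi z = (k ^ z) *: (zpow h hi z * u).
Proof.
move=> e1 e2 k0 E; have E' : u * hi = k^-1 *: (hi * u).
  rewrite -[u in LHS]mul1r -{1}e2 -!mulrA [h * (u * hi)]mulrA -[h * u](scalerK k0) -E.
  by rewrite -scalerAl -mulrA e1 mulr1 scalerAr.
elim/zpow_ind: z => [|z IH|z IH]; first by rewrite /= expr0 mulr1 mul1r expr0z scale1r.
  by rewrite zpowS // mulrA E -scalerAl -mulrA IH -scalerAr scalerA mulrA mulrC expfzDr // expr1z.
by rewrite zpowP // mulrA E' -scalerAl -mulrA IH -scalerAr scalerA mulrA mulrC expfzDr // exprN1.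
Qed.

Lemma comm_zpow h hi u z : GRing.comm u h -> GRing.comm u hi -> GRing.comm u (zpow h hi z).
Proof. by move=> c1 c2; case: z => m /=; exact: commrX. Qed.

Lemma qcomm_prod (I : Type) (r : seq I) (F : I -> A) (k : I -> K) u :
  (forall i, u * F i = k i *: (F i * u)) ->
  u * \prod_(i <- r) F i = (\prod_(i <- r) k i) *: (\prod_(i <- r) F i * u).
Proof.
move=> E; elim: r => [|i r IH]; first by rewrite !big_nil scale1r mulr1 mul1r.
by rewrite !big_cons mulrA E -scalerAl -[F i * u * _]mulrA IH -scalerAr scalerA mulrA.
Qed.

(** The product is ordered, and [u] travels to slot [j] through factors with which it commutes.
    Nothing is required between [u] and [F j]. *)
Lemma mul_prod_slot (I : finType) (F : I -> A) (j : I) u :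
  (forall i, i != j -> GRing.comm u (F i)) ->
  u * \prod_i F i = \prod_i (if i == j then u * F i else F i).
Proof.
move=> E; have gen (r : seq I) : uniq r -> u * \prod_(i <- r) F i =
    if j \in r then \prod_(i <- r) (if i == j then u * F i else F i)
    else \prod_(i <- r) F i * u.
  elim: r => [|i r IH] /=; first by rewrite !big_nil mulr1 mul1r.
  move=> /andP[ir ur]; rewrite !big_cons inE eq_sym; case: eqVneq => [ij|ij] /=.
    rewrite mulrA; congr (_ * _); rewrite big_seq [RHS]big_seq; apply: eq_bigr => l lr.
    by case: eqP => // lj; rewrite ij -lj lr in ir.
  by rewrite mulrA E // -mulrA IH //; case: ifP; rewrite // mulrA.
by rewrite gen ?index_enum_uniq // mem_index_enum.
Qed.

End Zpow.

Section Presentation.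
Variables (K : fieldType) (n d : nat) (q : 'I_n -> K).
Hypothesis hq0 : forall i, q i != 0.
Variables (A : algType K) (x y h hi : 'I_n -> A).
Hypothesis HA : is_A_presentation d q x y h hi.
Implicit Types (al be : {ffun 'I_n -> int}) (i j : 'I_n).

Lemma hK i : h i * hi i = 1. Proof. by have [[/(_ i)[[]]]] := HA. Qed.
Lemma hiK i : hi i * h i = 1. Proof. by have [[/(_ i)[[]]]] := HA. Qed.
Lemma xh i : x i * h i = q i *: (h i * x i). Proof. by have [[/(_ i)[]]] := HA. Qed.
Lemma yh i : y i * h i = (q i)^-1 *: (h i * y i). Proof. by have [[/(_ i)[]]] := HA. Qed.
Lemma xy i : x i * y i = a_d d (q i *: h i). Proof. by have [[/(_ i)[]]] := HA. Qed.
Lemma yx i : y i * x i = a_d d (h i). Proof. by have [[/(_ i)[]]] := HA. Qed.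

Lemma gen_comm i j u v : i != j -> u \in [:: h i; hi i; x i; y i] ->
  v \in [:: h j; hi j; x j; y j] -> GRing.comm u v.
Proof. by move=> ij hu hv; have [[_ /(_ i j ij u v hu hv)]] := HA. Qed.

Definition hmonomial al : A := \prod_j zpow (h j) (hi j) (al j).
(** Here [y j] is not an inverse of [x j]: [zpow] only selects powers of [x j] for nonnegative
    exponents and powers of [y j] for negative ones. *)
Definition zmonomial be : A := \prod_j zpow (x j) (y j) (be j).
Notation hmon := hmonomial.
Notation zmon := zmonomial.

Lemma h_hmon j al : h j * hmon al = hmon (al + dl j 1).
Proof.
rewrite /hmon (mul_prod_slot (j := j)) => [|i ij].
  apply: eq_bigr => i _; rewrite !ffunE; case: eqP => [->|]; last by rewrite addr0.
  by rewrite zpowS // hK.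
by apply: comm_zpow; apply: (@gen_comm j i); rewrite ?inE ?eqxx ?orbT // eq_sym.
Qed.

Lemma hi_hmon j al : hi j * hmon al = hmon (al + dl j (-1)).
Proof.
rewrite /hmon (mul_prod_slot (j := j)) => [|i ij].
  apply: eq_bigr => i _; rewrite !ffunE; case: eqP => [->|]; last by rewrite addr0.
  by rewrite zpowP // hiK.
by apply: comm_zpow; apply: (@gen_comm j i); rewrite ?inE ?eqxx ?orbT // eq_sym.
Qed.

Lemma h_comm i j : GRing.comm (h i) (h j).
Proof. by have [->//|ij] := eqVneq i j; apply: (gen_comm ij); rewrite ?inE ?eqxx ?orbT. Qed.

Lemma hhi_comm i j : GRing.comm (h i) (hi j).
Proof.
have [->|ij] := eqVneq i j; first by rewrite /GRing.comm hK hiK.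
by apply: (gen_comm ij); rewrite ?inE ?eqxx ?orbT.
Qed.

Lemma hihi_comm i j : GRing.comm (hi i) (hi j).
Proof. by have [->//|ij] := eqVneq i j; apply: (gen_comm ij); rewrite ?inE ?eqxx ?orbT. Qed.

Lemma comm_hmon u al : (forall i, GRing.comm u (h i)) -> (forall i, GRing.comm u (hi i)) ->
  GRing.comm u (hmon al).
Proof. by move=> c1 c2; apply: commr_prod => i _; exact: comm_zpow. Qed.

Lemma h_hmon_comm j al : GRing.comm (h j) (hmon al).
Proof. by apply: comm_hmon => i; [exact: h_comm|exact: hhi_comm]. Qed.

Lemma x_hmon j al : exists k, x j * hmon al = k *: (hmon al * x j).
Proof.
exists (\prod_i (if i == j then q i else 1) ^ (al i)); apply: qcomm_prod => i.
have [->|ij] := eqVneq i j.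
  by apply: qcomm_zpow; rewrite ?hK ?hiK ?hq0 ?xh.
apply: qcomm_zpow; rewrite ?hK ?hiK ?oner_neq0 // scale1r.
by apply: (@gen_comm j i); rewrite ?inE ?eqxx ?orbT // eq_sym.
Qed.

Lemma y_hmon j al : exists k, y j * hmon al = k *: (hmon al * y j).
Proof.
exists (\prod_i (if i == j then (q i)^-1 else 1) ^ (al i)); apply: qcomm_prod => i.
have [->|ij] := eqVneq i j.
  by apply: qcomm_zpow; rewrite ?hK ?hiK ?invr_eq0 ?hq0 ?yh.
apply: qcomm_zpow; rewrite ?hK ?hiK ?oner_neq0 // scale1r.
by apply: (@gen_comm j i); rewrite ?inE ?eqxx ?orbT // eq_sym.
Qed.

Lemma gen_comm_zpow j i u b : i != j -> u \in [:: h j; hi j; x j; y j] ->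
  GRing.comm u (zpow (x i) (y i) b).
Proof.
move=> ij hu; apply: comm_zpow; apply: (@gen_comm j i) => //;
  by rewrite ?inE ?eqxx ?orbT // eq_sym.
Qed.

Lemma a_d_comm_zpow j i (k : K) b : i != j -> GRing.comm (a_d d (k *: h j)) (zpow (x i) (y i) b).
Proof.
move=> ij; apply: commr_sym; apply: commrB; last exact: commr1.
apply: commrX; rewrite /GRing.comm -scalerAr -scalerAl; congr (_ *: _).
by apply: commr_sym; apply: (gen_comm_zpow _ ij); rewrite inE eqxx.
Qed.

(** For a negative exponent [x j] meets a [y j], and the relation for [x j * y j] leaves the factor
    [a_d]. *)
Lemma x_zmon j be : x j * zmon be = zmon (be + dl j 1) \/
  x j * zmon be = a_d d (q j *: h j) * zmon (be + dl j 1).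
Proof.
rewrite /zmon !(mul_prod_slot (j := j)); first last.
- by move=> i ij; apply: (gen_comm_zpow _ ij); rewrite ?inE ?eqxx ?orbT.
- by move=> i ij; exact: a_d_comm_zpow.
case E: (be j) => [m|m]; [left|right]; apply: eq_bigr => i _;
  rewrite !ffunE; case: eqP => [->|]; rewrite ?addr0 // E.
  by rewrite PoszS /= exprS.
by rewrite -xy; case: m {E} => [|m]; rewrite ?NegzS /= ?expr0 ?mulr1 // [in LHS]exprS mulrA.
Qed.

(** The scalar 1 is kept so that the extra factor has the same shape [a_d d (k *: h j)] as for
    [x j]. *)
Lemma y_zmon j be : y j * zmon be = zmon (be + dl j (-1)) \/
  y j * zmon be = a_d d (1 *: h j) * zmon (be + dl j (-1)).
Proof.
rewrite /zmon !(mul_prod_slot (j := j)); first last.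
- by move=> i ij; apply: (gen_comm_zpow _ ij); rewrite ?inE ?eqxx ?orbT.
- by move=> i ij; exact: a_d_comm_zpow.
case E: (be j) => [[|m]|m]; [left|right|left]; apply: eq_bigr => i _;
  rewrite !ffunE; case: eqP => [->|]; rewrite ?addr0 // E.
- by rewrite add0r /= expr0 mulr1 expr1.
- by rewrite PoszK scale1r -yx /= exprS mulrA.
by rewrite NegzP /= -exprS.
Qed.

Notation T := (qtorus hq0).
Notation U g := (tmon (qbichar hq0) (g : lattice n)).

(** Only a linear map: the torus serves here as the vector space with basis the exponents
    [(al, be)]. *)
Definition normal_form : {linear T -> A} := tlext (fun g : lattice n => hmon g.1 * zmon g.2).

Lemma normal_formU g : normal_form (U g) = hmon g.1 * zmon g.2.
Proof. exact: tlextU. Qed.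

Lemma hmon0 : hmon 0 = 1.
Proof. by apply: big1 => i _; rewrite ffunE /= expr0. Qed.

Lemma zmon0 : zmon 0 = 1.
Proof. by apply: big1 => i _; rewrite ffunE /= expr0. Qed.

(** The image contains 1 and is stable under left multiplication by each generator, which is what
    [gen_ind] asks for. *)
Lemma normal_form_surj a : exists t, a = normal_form t.
Proof.
apply: (gen_ind HA (P := fun a => exists t, a = normal_form t)).
- by exists (U 0); rewrite normal_formU hmon0 zmon0 mulr1.
- by move=> k _ _ [t1 ->] [t2 ->]; exists (k *: t1 + t2); rewrite linearP.
move=> j _ [t ->].
pose P a := exists t, a = normal_form t.
have Plin (u : A) : (forall al be, P (u * (hmon al * zmon be))) -> forall t', P (u * normal_form t').
  move=> Pm t'; rewrite [t']twalgE linear_sum mulr_sumr.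
  apply: (big_ind P); first by exists 0; rewrite linear0.
    by move=> _ _ [t1 ->] [t2 ->]; exists (t1 + t2); rewrite linearD.
  move=> g _; rewrite linearZ /= normal_formU -scalerAr.
  by have [t1 ->] := Pm g.1 g.2; exists (tcoef g t' *: t1); rewrite linearZ.
have Ph t' : P (h j * normal_form t').
  by apply: Plin => al be; exists (U (al + dl j 1, be)); rewrite normal_formU mulrA h_hmon.
have Pa (k : K) t' : P (a_d d (k *: h j) * normal_form t').
  rewrite /a_d mulrBl mul1r exprZn -scalerAl.
  have [t1 ->] : P (h j ^+ d * normal_form t').
    elim: (d) => [|m [t1 E]]; first by exists t'; rewrite mul1r.
    by rewrite exprS -mulrA E; exact: Ph.
  by exists (k ^+ d *: t1 - t'); rewrite linearB linearZ.
have Pa' (k : K) al be : P (hmon al * (a_d d (k *: h j) * zmon be)).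
  rewrite mulrA; have -> : hmon al * a_d d (k *: h j) = a_d d (k *: h j) * hmon al.
    apply: commrB; last exact: commr1.
    apply: commrX; rewrite /GRing.comm -scalerAr -scalerAl; congr (_ *: _).
    by apply: commr_sym; exact: h_hmon_comm.
  by rewrite -mulrA -(normal_formU (al, be)); exact: Pa.
have PZ (k : K) a' : P a' -> P (k *: a') by move=> [t1 ->]; exists (k *: t1); rewrite linearZ.
split; apply: Plin => al be; rewrite mulrA.
- have [k ->] := x_hmon j al; rewrite -scalerAl -mulrA; apply: PZ.
  have [->|->] := x_zmon j be; last exact: Pa'.
  by exists (U (al, be + dl j 1)); rewrite normal_formU.
- have [k ->] := y_hmon j al; rewrite -scalerAl -mulrA; apply: PZ.
  have [->|->] := y_zmon j be; last exact: Pa'.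
  by exists (U (al, be + dl j (-1))); rewrite normal_formU.
- by exists (U (al + dl j 1, be)); rewrite normal_formU h_hmon.
by exists (U (al + dl j (-1), be)); rewrite normal_formU hi_hmon.
Qed.

End Presentation.

(** * The embedding into the quantum torus *)

Section Embedding.
Variables (K : fieldType) (n d : nat) (q : 'I_n -> K).
Hypothesis hd : (0 < d)%N.
Hypothesis hq0 : forall i, q i != 0.
Variables (A : algType K) (x y h hi : 'I_n -> A).
Hypothesis HA : is_A_presentation d q x y h hi.
Notation T := (qtorus hq0).
Notation U g := (tmon (qbichar hq0) (g : lattice n)).
Notation theta := (@normal_form _ _ _ hq0 _ x y h hi).
Notation hmon := (@hmonomial _ _ _ h hi).
Notation zmon := (@zmonomial _ _ _ x y).
Implicit Types (al be : {ffun 'I_n -> int}) (i j : 'I_n) (t : T).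

Variable phi : {lrmorphism A -> T}.
Hypothesis phiE : forall i, [/\ phi (x i) = xT hq0 i, phi (y i) = yT hq0 d i,
  phi (h i) = hT hq0 i & phi (hi i) = hiT hq0 i].

Lemma phi_x i : phi (x i) = xT hq0 i. Proof. by case: (phiE i). Qed.
Lemma phi_y i : phi (y i) = yT hq0 d i. Proof. by case: (phiE i). Qed.
Lemma phi_h i : phi (h i) = hT hq0 i. Proof. by case: (phiE i). Qed.
Lemma phi_hi i : phi (hi i) = hiT hq0 i. Proof. by case: (phiE i). Qed.

(** The condition [0 <= s < k] survives left multiplication by every generator. Only [y_j] endangers
    it, by lowering [s] and [k] together: this fails just when [s = 0], and there the factor
    [h_j^d - 1] of the image of [y_j] takes the value [q_j^0 - 1 = 0]. *)
Lemma evT_phi a j (k s : int) : 0 <= s -> s < k -> evT hq0 j k s (phi a) = 0.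
Proof.
move: a k s; pose P a := forall k s, 0 <= s -> s < k -> evT hq0 j k s (phi a) = 0.
suff: forall a, P a by [].
apply: (gen_ind HA (P := P)) => [k s s0 sk|k u v Pu Pv l s s0 sl|i u Pu].
- rewrite rmorph1 -tmon0 evTU /= ffunE; case: eqP => // /eqP.
  by rewrite eq_sym oppr_eq0 gt_eqF // (le_lt_trans s0).
- by rewrite linearP linearP /= Pu // Pv // scaler0 addr0.
have [->|ij] := eqVneq i j; split=> k s s0 sk; rewrite rmorphM /=.
- by rewrite phi_x evT_xl Pu ?mulr0 // ?ltrD2r // addr_ge0.
- rewrite phi_y -mulrA evT_adl evT_xl.
  have [->|sn0] := eqVneq s 0; first by rewrite mul0r expr0z subrr scale0r.
  rewrite Pu ?mulr0 ?scaler0 ?ltrD2r //; lia.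
- by rewrite phi_h evT_hl Pu // scaler0.
- by rewrite phi_hi evT_hl Pu // scaler0.
- by rewrite phi_x evT_Ul ?Pu ?mulr0 //= ffunE // eq_sym (negPf ij).
- rewrite phi_y -mulrA evT_adl_neq // evT_Ul ?Pu ?mulr0 //= ffunE //.
  by rewrite eq_sym (negPf ij).
- by rewrite phi_h evT_Ul ?Pu ?mulr0 //= ffunE // eq_sym (negPf ij).
by rewrite phi_hi evT_Ul ?Pu ?mulr0 //= ffunE // eq_sym (negPf ij).
Qed.

Definition xhomog be t := forall g, g \in tsupp t -> g.2 = be.

Lemma xhomogM be1 be2 t1 t2 : xhomog be1 t1 -> xhomog be2 t2 -> xhomog (be1 + be2) (t1 * t2).
Proof. by move=> h1 h2 g /tsuppM[g1 [g2 [s1 s2 ->]]] /=; rewrite (h1 _ s1) (h2 _ s2). Qed.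

Lemma tsuppU g : tsupp (U g) = [fset g]%fset.
Proof.
apply/fsetP => g'; rewrite in_tsupp tcoefU in_fset1 [g' == g]eq_sym.
by case: (g == g'); rewrite ?oner_neq0 ?eqxx.
Qed.

Lemma U_neq0 g : U g != 0.
Proof.
apply/eqP => U0; have := tcoefU (qbichar hq0) g g; rewrite U0 linear0 eqxx => /eqP.
by rewrite eq_sym oner_eq0.
Qed.

Lemma xhomogU g : xhomog g.2 (U g).
Proof. by move=> g'; rewrite tsuppU inE => /eqP->. Qed.

Lemma xhomog1 : xhomog 0 1.
Proof. by rewrite -(tmon0 (qbichar hq0)); exact: xhomogU. Qed.

Lemma xhomog_lin be (k : K) t1 t2 : xhomog be t1 -> xhomog be t2 -> xhomog be (k *: t1 + t2).
Proof.
move=> h1 h2 g; rewrite in_tsupp linearP /= => nz.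
have [/h1//|] := boolP (g \in tsupp t1); have [/h2//|] := boolP (g \in tsupp t2).
by rewrite !in_tsupp !negbK => /eqP g2 /eqP g1; rewrite g1 g2 scaler0 addr0 eqxx in nz.
Qed.

Lemma hT_xhomog m j : xhomog 0 (hT hq0 j ^+ m).
Proof. by rewrite hTX; exact: xhomogU. Qed.

Lemma a_d_neq0 j : a_d d (hT hq0 j) != 0.
Proof.
apply/eqP => /(congr1 (tcoef 0)); rewrite /a_d hTX linearB -(tmon0 (qbichar hq0)) /= !tcoefU.
rewrite eqxx linear0; case: eqP => [[/ffunP/(_ j)]|_ /eqP]; last by rewrite sub0r oppr_eq0 oner_eq0.
by rewrite !ffunE eqxx => -[d0]; have := hd; rewrite d0.
Qed.

Lemma yT_xhomog j : xhomog (dl j (-1)) (yT hq0 d j).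
Proof.
rewrite -[dl j _]add0r; apply: xhomogM; last exact: xhomogU.
by rewrite /a_d addrC -scaleN1r; apply: xhomog_lin; [exact: xhomog1|exact: hT_xhomog].
Qed.

Lemma yT_neq0 j : yT hq0 d j != 0.
Proof. by apply: qtorus_mul_neq0; [exact: a_d_neq0|exact: U_neq0]. Qed.

Lemma qtorus_expf_neq0 t m : t != 0 -> t ^+ m != 0.
Proof. by move=> nz; elim: m => [|m IH]; rewrite ?oner_neq0 // exprS qtorus_mul_neq0. Qed.

Lemma xhomogX be t m : xhomog be t -> xhomog (be *+ m) (t ^+ m).
Proof.
by move=> ht; elim: m => [|m IH]; [exact: xhomog1|rewrite exprS mulrS; exact: xhomogM].
Qed.

Lemma phi_zmon be : xhomog be (phi (zmon be)) /\ phi (zmon be) != 0.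
Proof.
rewrite /zmonomial rmorph_prod /=.
have zj j : xhomog (dl j (be j)) (phi (zpow (x j) (y j) (be j))) /\
    phi (zpow (x j) (y j) (be j)) != 0.
  case: (be j) => m /=; rewrite rmorphXn /= ?phi_x ?phi_y; split.
  - have -> : dl j m = dl j 1 *+ m.
      by apply/ffunP => i; rewrite !ffunE ffunMnE ffunE; case: eqP; rewrite ?mul0rn -?pmulrn ?natz.
    by apply: xhomogX; exact: xhomogU.
  - by apply: qtorus_expf_neq0; exact: U_neq0.
  - have -> : dl j (Negz m) = dl j (-1) *+ m.+1.
      apply/ffunP => i; rewrite ffunMnE !ffunE NegzE; case: eqP; rewrite ?mul0rn //.
      by rewrite mulNrn -?pmulrn ?natz.
    by apply: xhomogX; exact: yT_xhomog.
  - by apply: qtorus_expf_neq0; exact: yT_neq0.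
have beE : be = \sum_j dl j (be j).
  apply/ffunP => i; rewrite sum_ffunE (bigD1 i) //= ffunE eqxx big1 ?addr0 // => j ij.
  by rewrite ffunE eq_sym (negPf ij).
rewrite [X in xhomog X]beE; elim: (index_enum _) => [|j r [IH1 IH2]].
  by rewrite !big_nil; split; [exact: xhomog1|exact: oner_neq0].
have [z1 z2] := zj j; rewrite !big_cons; split; first exact: xhomogM.
exact: qtorus_mul_neq0.
Qed.

Lemma phi_hmon al : phi (hmon al) = U (al, 0).
Proof.
rewrite /hmonomial rmorph_prod /=.
have alE : al = \sum_j dl j (al j).
  apply/ffunP => i; rewrite sum_ffunE (bigD1 i) //= ffunE eqxx big1 ?addr0 // => j ij.
  by rewrite ffunE eq_sym (negPf ij).
rewrite [in RHS]alE; elim: (index_enum _) => [|j r IH]; first by rewrite !big_nil tmon0.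
rewrite !big_cons IH; have -> : phi (zpow (h j) (hi j) (al j)) = U (dl j (al j), 0).
  have [hK hK'] := hT_inv hq0 j.
  have -> : phi (zpow (h j) (hi j) (al j)) = zpow (hT hq0 j) (hiT hq0 j) (al j).
    by case: (al j) => m /=; rewrite rmorphXn /= ?phi_h ?phi_hi.
  elim/zpow_ind: (al j) => [|z IHz|z IHz]; first by rewrite dl0 U_eq1.
    by rewrite zpowS // IHz UM qpair0l scale1r addrC; congr (U (pair _ _)); rewrite ?addr0 ?dlD.
  by rewrite zpowP // IHz UM qpair0l scale1r addrC; congr (U (pair _ _)); rewrite ?addr0 ?dlD.
by rewrite UM qpair0l scale1r; congr (U (pair _ _)); rewrite ?addr0.
Qed.

(* [xproj be] is the component of degree [be] in the [x_j], [hpart] sets the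
   [x_j] to [1]. *)
Definition xproj be : {linear T -> T} :=
  tlext (fun g : lattice n => if g.2 == be then U g else 0).
Definition hpart : {linear T -> T} := tlext (fun g : lattice n => U (g.1, 0)).
(** The same specialization as [hpart], with values in the Laurent polynomials in the [h_j] inside
    [A]. *)
Definition h_lift : {linear T -> A} := tlext (fun g : lattice n => hmon g.1).
Notation hlift := h_lift.

Lemma xproj_homog be be' t : xhomog be' t -> xproj be t = if be' == be then t else 0.
Proof.
move=> ht; rewrite [t]twalgE linear_sum big_seq (eq_bigr (fun g => if be' == be then tcoef g t *: U g else 0)).
  by case: eqP => _; [rewrite -big_seq|rewrite big1].
by move=> g /ht gb; rewrite linearZ /= tlextU gb; case: eqP; rewrite ?scaler0.
Qed.

Lemma phi_hlift t : phi (hlift t) = hpart t.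
Proof.
pose f : {linear T -> T} := phi \o hlift.
by apply: (@twalg_linear_ext _ _ _ _ f hpart _ t) => g /=; rewrite !tlextU phi_hmon.
Qed.

Lemma theta_xproj be t : theta (xproj be t) = hlift (xproj be t) * zmon be.
Proof.
rewrite [t]twalgE !linear_sum mulr_suml; apply: eq_bigr => g _.
rewrite !linearZ /= tlextU -scalerAl; congr (_ *: _).
by case: eqP => [<-|_]; rewrite ?linear0 ?mul0r // normal_formU tlextU.
Qed.

Lemma phi_theta_xproj be t : xproj be (phi (theta t)) = phi (theta (xproj be t)).
Proof.
pose f1 : {linear T -> T} := xproj be \o (phi \o theta).
pose f2 : {linear T -> T} := (phi \o theta) \o xproj be.
apply: (@twalg_linear_ext _ _ _ _ f1 f2 _ t) => g /=.
rewrite normal_formU rmorphM /= phi_hmon tlextU; have [hz _] := phi_zmon g.2.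
have hg : xhomog g.2 (U (g.1, 0) * phi (zmon g.2)).
  by rewrite -[g.2]add0r; apply: xhomogM; rewrite ?add0r //; exact: xhomogU.
rewrite (xproj_homog _ hg); case: eqP; rewrite ?linear0 ?rmorph0 // => _.
by rewrite normal_formU rmorphM /= phi_hmon.
Qed.

(** Write [a] as the normal form of [t]. The component of [phi a] in degree [be] is the [h]-part of
    the component of [t], times the nonzero [phi (zmon be)]. As the torus has no zero divisors,
    every [h]-part vanishes, and with it every coefficient of [t]. *)
Lemma phi_inj a : phi a = 0 -> a = 0.
Proof.
have [t ->] := normal_form_surj hq0 HA a => t0.
suff -> : t = 0 by rewrite linear0.
rewrite [t]twalgE big_seq big1 // => g _.
have := phi_theta_xproj g.2 t; rewrite t0 linear0 theta_xproj rmorphM /= phi_hlift => /esym/eqP.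
have [_ znz] := phi_zmon g.2.
have [hp0 _|hnz] := eqVneq (hpart (xproj g.2 t)) 0; last first.
  by rewrite (negPf (qtorus_mul_neq0 hnz znz)).
suff -> : tcoef g t = tcoef (g.1, 0) (hpart (xproj g.2 t)).
  by rewrite hp0 linear0 scale0r.
pose f : {linear T -> K^o} := tcoef ((g.1, 0) : lattice n) \o (hpart \o xproj g.2).
apply: (@twalg_linear_ext _ _ _ _ (tcoef g) f _ t) => g' /=.
rewrite tlextU; case: eqP => [e2|ne]; last first.
  by rewrite !linear0 tcoefU; case: eqP => // e; case: ne; rewrite e.
rewrite tlextU !tcoefU; congr (_%:R); rewrite -!pair_eqE /pair_eq /= e2 eqxx andbT.
by rewrite eqxx andbT.
Qed.

(** Projecting a normal form of [a] to degree [be] does not change its image under [phi], hence does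
    not change [a]. The element is thus a Laurent polynomial in the [h_j] times one [zmon be]. *)
Lemma xhomog_phi be a : xhomog be (phi a) ->
  exists t, [/\ forall g, g \in tsupp t -> g.2 = 0, a = hlift t * zmon be & phi (hlift t) = t].
Proof.
have [t ->] := normal_form_surj hq0 HA a => ht; exists (hpart (xproj be t)).
have hp t' : hpart (hpart t') = hpart t'.
  pose f : {linear T -> T} := hpart \o hpart.
  by apply: (@twalg_linear_ext _ _ _ _ f hpart _ t') => g /=; rewrite !tlextU.
have hl t' : hlift (hpart t') = hlift t'.
  pose f : {linear T -> A} := hlift \o hpart.
  by apply: (@twalg_linear_ext _ _ _ _ f hlift _ t') => g /=; rewrite !tlextU.
split; last by rewrite phi_hlift hp.
  move: (xproj be t) => t'; rewrite [t']twalgE linear_sum.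
  apply: (big_ind (xhomog 0)) => [g|t1 t2 h1 h2|g _].
  - by rewrite in_tsupp linear0 eqxx.
  - by rewrite -[t1]scale1r; exact: xhomog_lin.
  - rewrite linearZ /= tlextU -[_ *: _]addr0; apply: xhomog_lin; first exact: xhomogU.
    by move=> g'; rewrite in_tsupp linear0 eqxx.
rewrite hl -theta_xproj; apply/eqP; rewrite -subr_eq0; apply/eqP/phi_inj.
by rewrite rmorphB /= -phi_theta_xproj (xproj_homog _ ht) eqxx subrr.
Qed.

End Embedding.

(** * Units and binomials *)

Section Laurent.
Variables (K : fieldType) (A : algType K) (h hi : A).
Hypotheses (hK : h * hi = 1) (hiK : hi * h = 1).

Lemma laurent_evalE P e : laurent_eval P e h hi = horner_alg h P * zpow h hi e.
Proof.
rewrite /laurent_eval -[in RHS](coefK P) poly_def linear_sum mulr_suml; apply: eq_bigr => k _ /=.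
by rewrite linearZ /= rmorphXn /= horner_algX -!scalerAl mul1r zpowD.
Qed.

Lemma laurent_shift P e (k : nat) : laurent_eval P (k%:Z + e) h hi = laurent_eval (P * 'X^k) e h hi.
Proof. by rewrite !laurent_evalE rmorphM rmorphXn /= horner_algX zpowD // mulrA. Qed.

Lemma laurentD P1 e1 P2 e2 : exists P e,
  laurent_eval P1 e1 h hi + laurent_eval P2 e2 h hi = laurent_eval P e h hi.
Proof.
pose e := Num.min e1 e2.
have [k1 ->] : exists k : nat, e1 = k%:Z + e by exists `|e1 - e|%N; rewrite /e; lia.
have [k2 ->] : exists k : nat, e2 = k%:Z + e by exists `|e2 - e|%N; rewrite /e; lia.
rewrite !laurent_shift; exists (P1 * 'X^k1 + P2 * 'X^k2), e.
by rewrite !laurent_evalE rmorphD mulrDl.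
Qed.

Lemma laurent_sum (I : Type) (r : seq I) (c : I -> K) (a : I -> int) :
  exists P e, \sum_(i <- r) c i *: zpow h hi (a i) = laurent_eval P e h hi.
Proof.
elim: r => [|i r [P [e IH]]].
  by exists 0, 0; rewrite big_nil laurent_evalE rmorph0 mul0r.
have [P' [e' E]] := laurentD (c i)%:P (a i) P e; exists P', e'.
by rewrite big_cons IH -E !laurent_evalE horner_algC -scalerAl mul1r.
Qed.

Lemma comm_laurent u P e : GRing.comm u h -> GRing.comm u hi ->
  GRing.comm u (laurent_eval P e h hi).
Proof.
move=> c1 c2; apply: commr_sum => k _; rewrite /GRing.comm -scalerAr -scalerAl.
by congr (_ *: _); exact: comm_zpow.
Qed.

End Laurent.

Section TorusElements.
Variables (K : fieldType) (n d : nat) (q : 'I_n -> K).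
Hypothesis hd : (0 < d)%N.
Hypothesis hq0 : forall i, q i != 0.
Variables (A : algType K) (x y h hi : 'I_n -> A).
Hypothesis HA : is_A_presentation d q x y h hi.
Notation T := (qtorus hq0).
Notation U g := (tmon (qbichar hq0) (g : lattice n)).
Notation hmon := (@hmonomial _ _ _ h hi).
Notation zmon := (@zmonomial _ _ _ x y).
Implicit Types (al be : {ffun 'I_n -> int}) (i j : 'I_n) (t : T).

Variable phi : {lrmorphism A -> T}.
Hypothesis phiE : forall i, [/\ phi (x i) = xT hq0 i, phi (y i) = yT hq0 d i,
  phi (h i) = hT hq0 i & phi (hi i) = hiT hq0 i].

Lemma tsupp_neq0 t : t != 0 -> exists g, g \in tsupp t.
Proof. by move=> /(lexmax_exists (@coords_sep n))[g []]; exists g. Qed.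

Lemma tsupp1 t g : (forall g', g' \in tsupp t -> g' = g) -> t = tcoef g t *: U g.
Proof.
move=> hg; apply/eqP; rewrite -subr_eq0; apply/eqP/tsupp_eq0/fsetP => g'.
rewrite in_fset0 in_tsupp linearB linearZ /= tcoefU; apply/negbTE; rewrite negbK.
have [<-|ne] := eqVneq g g'; first by rewrite [_ *: _]mulr1 subrr.
rewrite [_ *: _]mulr0 subr0 -[_ == 0]negbK -in_tsupp; apply/negP => /hg gg.
by rewrite gg eqxx in ne.
Qed.

(** The product 1 has degree 0 for every coordinate, so each exponent of [phi u] is opposite to each
    exponent of [phi u'], and both are single monomials. Neither can have a negative exponent in
    some [x_j], hence both have degree 0 in the [x_j]. *)
Lemma phi_unit u u' : u * u' = 1 -> u' * u = 1 ->
  exists (c : K) al, c != 0 /\ phi u = c *: U (al, 0).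
Proof.
move=> e1 e2; have E : phi u * phi u' = 1 by rewrite -rmorphM e1 rmorph1.
have nz : phi u * phi u' != 0 by rewrite E oner_neq0.
have nz1 : phi u != 0 by apply: contraNneq nz => ->; rewrite mul0r.
have nz2 : phi u' != 0 by apply: contraNneq nz => ->; rewrite mulr0.
have hom (l : {additive lattice n -> int}) g1 g2 :
    g1 \in tsupp (phi u) -> g2 \in tsupp (phi u') -> l g1 + l g2 = 0.
  move=> s1 s2; apply: (homog_factors (@coords_sep n) nz1 nz2 _ s1 s2) => g.
  by rewrite E -(tmon0 (qbichar hq0)) tsuppU in_fset1 => /eqP->; rewrite raddf0.
have opp g1 g2 : g1 \in tsupp (phi u) -> g2 \in tsupp (phi u') -> g1 = - g2.
  move=> s1 s2; case: g1 g2 s1 s2 => [a1 b1] [a2 b2] s1 s2; congr pair; apply/ffunP => j.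
    by apply/eqP; rewrite ffunE -addr_eq0; apply/eqP; exact: (hom (hexp j) _ _ s1 s2).
  by apply/eqP; rewrite ffunE -addr_eq0; apply/eqP; exact: (hom (xexp j) _ _ s1 s2).
have [g1 s1] := tsupp_neq0 nz1; have [g2 s2] := tsupp_neq0 nz2.
have g12 := opp _ _ s1 s2.
have E1 : phi u = tcoef g1 (phi u) *: U g1.
  by apply: tsupp1 => g sg; rewrite (opp _ _ sg s2).
have E2 : phi u' = tcoef g2 (phi u') *: U g2.
  by apply: tsupp1 => g sg; rewrite g12 in s1; apply: oppr_inj; rewrite -(opp _ _ s1 sg).
(* At [s = 0] a nonzero monomial of negative degree in [x_j] has nonzero evaluation, against
   [evT_phi]. *)
have nneg v g c : phi v = c *: U g -> c != 0 -> forall j, 0 <= g.2 j.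
  move=> Ev c0 j; rewrite leNgt; apply/negP => gj.
  have /eqP : evT hq0 j (- g.2 j) 0 (phi v) = 0.
    by apply: (evT_phi hd HA phiE); rewrite ?oppr_gt0.
  rewrite Ev linearZ /= evTU opprK eqxx mul0r expr0z scale1r.
  by rewrite scaler_eq0 (negPf c0) (negPf (U_neq0 _ _)).
exists (tcoef g1 (phi u)), g1.1; split; first by rewrite -in_tsupp.
rewrite {1}E1; congr (_ *: U _); case: g1 g12 s1 E1 => a b g12 s1 E1; congr pair.
apply/ffunP => j; rewrite ffunE; apply/eqP; rewrite eq_le.
have := nneg _ _ _ E1; rewrite -in_tsupp => /(_ s1 j) /= ->; rewrite andbT.
have := nneg _ _ _ E2; rewrite -in_tsupp => /(_ s2 j).
by move: g12 => [_ ->]; rewrite ffunE oppr_le0.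
Qed.

Lemma UaX al m : U (al, 0) ^+ m = U (al *+ m, 0).
Proof.
elim: m => [|m IH]; first by rewrite mulr0n expr0 tmon0.
by rewrite exprS IH UM qpair0l scale1r mulrS; congr (U (pair _ _)); rewrite addr0.
Qed.

(** After evaluation the first term is a scalar times a monomial in the other [h_i]. It can cancel 1
    only if that monomial is trivial, and then the scalar is 1; [d > 0] removes the factor [d] from
    the exponents. *)
Lemma evT_binomial j (s : int) al (C : K) :
  evT hq0 j 0 s (C *: U (al *+ d, 0) - 1) = 0 ->
  (forall i, i != j -> al i = 0) /\ C * q j ^ (s * (al j *+ d)) = 1.
Proof.
rewrite linearB linearZ /= -(tmon0 (qbichar hq0)) !evTU /= !ffunE oppr0 eqxx ffunMnE.
rewrite mulr0 expr0z scale1r scalerA.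
have -> : clr j (0 : lattice n) = 0.
  by congr pair; apply/ffunP => i; rewrite !ffunE if_same.
move=> /(congr1 (tcoef 0)); rewrite linearB linearZ /= !tcoefU linear0 eqxx => /eqP.
rewrite subr_eq0; have [g0|_] := eqVneq (clr j ((al *+ d, 0) : lattice n)) 0; last by rewrite /GRing.scale /= mulr0 eq_sym oner_eq0.
rewrite /GRing.scale /= mulr1 => /eqP ->; split=> // i ij.
move: g0 => [/ffunP/(_ i)]; rewrite !ffunE (negPf ij) ffunMnE /= => /eqP.
by rewrite mulrn_eq0 -[d == 0]leqn0 leqNgt hd => /eqP.
Qed.

(** Each monomial of [phi Y] has degree [- be j] in [x_j], so evaluating the product in degree 0
    evaluates [phi X] in degree [be j], within the range of [evT_phi]. *)
Lemma evT_product X Y j be (s : int) : xhomog be (phi X) -> xhomog (- be) (phi Y) ->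
  0 <= s -> s < - be j -> evT hq0 j 0 s (phi X * phi Y) = 0.
Proof.
move=> hX hY s0 sb; rewrite [phi Y]twalgE mulr_sumr linear_sum big_seq big1 // => g gY.
rewrite -scalerAr linearZ /= evT_Ur (hY _ gY) ffunE.
by rewrite (evT_phi hd HA phiE) ?mul0r ?scaler0 ?add0r.
Qed.

Lemma zmon_dl j b : zmon (dl j b) = zpow (x j) (y j) b.
Proof.
have -> : zpow (x j) (y j) b = zpow (x j) (y j) b * zmon 0 by rewrite zmon0 mulr1.
rewrite /zmonomial (mul_prod_slot (j := j)) => [|i ij].
  by apply: eq_bigr => i _; rewrite !ffunE; case: eqP => [->|_]; rewrite /= expr0 ?mulr1.
by rewrite ffunE /= expr0; exact: commr1.
Qed.

Lemma phi_zpow_h j z : phi (zpow (h j) (hi j) z) = U (dl j z, 0).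
Proof.
rewrite -(phi_hmon phiE) /hmonomial; congr (phi _).
have -> : zpow (h j) (hi j) z = zpow (h j) (hi j) z * hmon 0 by rewrite hmon0 mulr1.
rewrite /hmonomial (mul_prod_slot (j := j)) => [|i ij].
  by apply: eq_bigr => i _; rewrite !ffunE; case: eqP => [->|_]; rewrite /= expr0 ?mulr1.
by rewrite ffunE /= expr0; exact: commr1.
Qed.

Lemma phi_eq u v : phi u = phi v -> u = v.
Proof.
move=> E; apply/eqP; rewrite -subr_eq0; apply/eqP/(phi_inj hd HA phiE).
by rewrite rmorphB /= E subrr.
Qed.

Lemma hmon_split j al : hmon al = zpow (h j) (hi j) (al j) * hmon (al - dl j (al j)).
Proof.
apply: phi_eq; rewrite rmorphM /= !(phi_hmon phiE) phi_zpow_h UM qpair0l scale1r.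
by congr (U (pair _ _)); rewrite ?addr0 // addrC subrK.
Qed.

Lemma hmonN al : hmon al * hmon (- al) = 1.
Proof.
apply: phi_eq; rewrite rmorphM rmorph1 /= !(phi_hmon phiE) UM qpair0l scale1r.
by rewrite U_eq1 //; congr pair; rewrite ?addr0 // addrN.
Qed.

End TorusElements.

(** * Images of the generators *)

Section Images.
Variables (K : fieldType) (n d : nat) (q : 'I_n -> K).
Hypothesis hd : (0 < d)%N.
Hypothesis hq0 : forall i, q i != 0.
Variables (A : algType K) (x y h hi : 'I_n -> A).
Hypothesis HA : is_A_presentation d q x y h hi.
Notation T := (qtorus hq0).
Notation U g := (tmon (qbichar hq0) (g : lattice n)).
Notation hmon := (@hmonomial _ _ _ h hi).
Notation zmon := (@zmonomial _ _ _ x y).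
Notation hlift := (@h_lift _ _ _ hq0 _ h hi).
Implicit Types (al be : {ffun 'I_n -> int}) (i j : 'I_n) (t : T).

Variable phi : {lrmorphism A -> T}.
Hypothesis phiE : forall i, [/\ phi (x i) = xT hq0 i, phi (y i) = yT hq0 d i,
  phi (h i) = hT hq0 i & phi (hi i) = hiT hq0 i].

Lemma xhomogZ be (k : K) t : xhomog be t -> xhomog be (k *: t).
Proof.
move=> ht; rewrite -[_ *: _]addr0; apply: xhomog_lin => // g.
by rewrite in_tsupp linear0 eqxx.
Qed.

Section ImageDegree.
Variables (k : K) (u u' X Y : A).
Hypotheses (k0 : k != 0) (kd : k ^+ d != 1) (uu' : u * u' = 1) (u'u : u' * u = 1).
Hypotheses (Xu : X * u = k *: (u * X)) (XY : X * Y = a_d d (k *: u)) (YX : Y * X = a_d d u).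

Lemma image_degree : exists j (tau : bool) (m : int) (gam : K),
  [/\ [/\ m != 0, gam != 0, q j ^ ((-1) ^+ tau * m) = k &
          gam ^+ d = k ^ (- (tau%:Z * d%:Z))],
      u = gam *: zpow (h j) (hi j) m,
      phi X != 0 /\ phi Y != 0,
      xhomog (dl j ((-1) ^+ tau)) (phi X) /\ xhomog (dl j (- (-1) ^+ tau)) (phi Y) &
      forall i g, i != j -> g \in tsupp (phi X * phi Y) -> g.1 i = 0].
Proof.
have [gam [al [gam0 uE]]] := phi_unit hd HA phiE uu' u'u.
have XYE : phi X * phi Y = (k * gam) ^+ d *: U (al *+ d, 0) - 1.
  by rewrite -rmorphM XY rmorph_a_d /= linearZ /= uE scalerA /a_d exprZn UaX.
have YXE : phi Y * phi X = gam ^+ d *: U (al *+ d, 0) - 1.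
  by rewrite -rmorphM YX rmorph_a_d /= uE /a_d exprZn UaX.
(* The leading coefficients differ by the factor [k^d], which is not 1, so the two binomials cannot
   both be 0. This covers the case [al = 0], in which both are scalars. *)
have nz0 : phi X * phi Y = 0 -> phi Y * phi X = 0 -> False.
  rewrite XYE YXE => /subr0_eq z1 /subr0_eq z2.
  have : ((k * gam) ^+ d - gam ^+ d) *: U (al *+ d, 0) = 0 by rewrite scalerBl z1 z2 subrr.
  move/eqP; rewrite scaler_eq0 (negPf (U_neq0 _ _)) orbF exprMn -{2}[gam ^+ d]mul1r -mulrBl.
  by rewrite mulf_eq0 subr_eq0 (negPf kd) expf_eq0 (negPf gam0) andbF.
have nX : phi X != 0 by apply/eqP => X0; apply: nz0; rewrite X0 ?mul0r ?mulr0.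
have nY : phi Y != 0 by apply/eqP => Y0; apply: nz0; rewrite Y0 ?mul0r ?mulr0.
have homD : xhomog 0 (phi X * phi Y).
  rewrite XYE addrC -scaleN1r; apply: xhomog_lin; first exact: xhomog1.
  by apply: xhomogZ; exact: xhomogU.
have hom i g1 g2 : g1 \in tsupp (phi X) -> g2 \in tsupp (phi Y) -> g1.2 i + g2.2 i = 0.
  apply: (homog_factors (l := xexp i) (@coords_sep n) nX nY) => g /homD.
  by rewrite /= /xexp => ->; rewrite ffunE.
have [gX sX] := tsupp_neq0 nX; have [gY sY] := tsupp_neq0 nY.
pose be := gX.2.
have hX : xhomog be (phi X).
  move=> g sg; apply/ffunP => i; apply: (@addIr _ (gY.2 i)).
  by rewrite (hom i _ _ sg sY) (hom i _ _ sX sY).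
have hY : xhomog (- be) (phi Y).
  by move=> g sg; apply/ffunP => i; rewrite ffunE; apply/eqP; rewrite -addr_eq0 addrC (hom i _ _ sX sg).
(* Leading monomials in [X * u = k *: (u * X)]; all monomials of [phi X] have the same degree
   [be]. *)
have kE : \prod_i q i ^ (be i * al i) = k.
  have E : phi X * U (al, 0) = k *: (U (al, 0) * phi X).
    apply: (scalerI gam0); rewrite scalerAr -uE -rmorphM Xu /= linearZ /= rmorphM /= uE.
    by rewrite -scalerAl !scalerA mulrC.
  have [g1 [g2 [s1 s2 c12]]] := bichar_of_qcomm (@coords_sep n) nX (U_neq0 hq0 _) E.
  move: s2 c12; rewrite tsuppU in_fset1 => /eqP-> /=; rewrite qpair0l mulr1 /qpair.
  by rewrite (hX _ s1).
(* Otherwise [k = 1], against [k^d != 1]. *)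
have [j] : exists j, be j * al j != 0.
  apply: contrapT => H; move/eqP: kd; apply; rewrite -kE big1 ?expr1n // => i _.
  have [->|ne] := eqVneq (be i * al i) 0; first by rewrite expr0z.
  by case: H; exists i.
rewrite mulf_eq0 negb_or => /andP[bej alj].
(* The evaluation lemma needs a left factor of negative degree in [x_i]: this is [phi X] if
   [be i < 0], and [phi Y] if [be i > 0], which brings in [Y X] with its other constant. *)
have evN i s : 0 <= s -> s < - be i ->
    (forall l, l != i -> al l = 0) /\ (k * gam) ^+ d * q i ^ (s * (al i *+ d)) = 1.
  move=> s0 si; apply: (@evT_binomial _ _ _ _ hd hq0 i s al).
  by rewrite -XYE; apply: (evT_product hd HA phiE hX hY).
have evP i s : 0 <= s -> s < be i ->
    (forall l, l != i -> al l = 0) /\ gam ^+ d * q i ^ (s * (al i *+ d)) = 1.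
  move=> s0 si; apply: (@evT_binomial _ _ _ _ hd hq0 i s al).
  rewrite -YXE; apply: (evT_product (be := - be) hd HA phiE) => //; first by rewrite opprK.
  by rewrite ffunE opprK.
have al_supp i : be i != 0 -> forall l, l != i -> al l = 0.
  have [bi|bi|//] := ltgtP (be i) 0 => _; last by have [] := evP i 0 (lexx _) bi.
  by have [] := evN i 0 (lexx _); rewrite ?oppr_gt0.
(* A second index [i] with [be i != 0] would force [al] to be supported at [i], although
   [al j != 0]. *)
have beE : be = dl j (be j).
  apply/ffunP => i; rewrite ffunE; have [->//|ij] := eqVneq i j.
  apply/eqP; apply: contraTT alj => bi; rewrite negbK (al_supp i bi) // eq_sym //.
have alE : al = dl j (al j).
  apply/ffunP => i; rewrite ffunE; have [->//|ij] := eqVneq i j.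
  exact: al_supp ij.
have kjE : q j ^ (be j * al j) = k.
  rewrite -kE (bigD1 j) //= big1 ?mulr1 // => i ij.
  by rewrite (al_supp j bej i ij) mulr0 expr0z.
(* Two consecutive points give [q_j^(d al_j) = 1], whose power with exponent [be j] is [k^d]. *)
have no2 (C : K) : C * q j ^ (0 * (al j *+ d)) = 1 -> C * q j ^ (1 * (al j *+ d)) = 1 -> False.
  rewrite mul0r expr0z mulr1 mul1r => ->; rewrite mul1r -mulr_natr natz => E.
  move/eqP: kd; apply; rewrite -kjE -[LHS]/(_ ^ d%:Z) exprz_exp -mulrA [be j * _]mulrC.
  by rewrite -exprz_exp E exp1rz.
have be1 : be j = 1 \/ be j = -1.
  have [b1|b1] := lerP (be j) 1; have [b2|b2] := lerP (-1) (be j); try by [lia].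
  - by case: (@no2 ((k * gam) ^+ d)); [apply: (evN j 0 _ _).2|apply: (evN j 1 _ _).2] => //; clear -b2; lia.
  - by case: (@no2 (gam ^+ d)); [apply: (evP j 0 _ _).2|apply: (evP j 1 _ _).2] => //; clear -b1; lia.
exists j, (be j == -1), (al j), gam.
have epsE : (-1) ^+ (be j == -1) = be j by case: be1 => ->.
have uE' : u = gam *: zpow (h j) (hi j) (al j).
  apply: (phi_eq hd HA phiE); rewrite linearZ /= (phi_zpow_h phiE) uE; congr (_ *: U (_, _)).
  exact: alE.
rewrite epsE; split=> //.
(* The point [s = 0] gives [gam^d = 1] from [Y X] if [be j = 1], and [(k gam)^d = 1] from [X Y] if
   [be j = -1]. *)
- split=> //; case: be1 => b1; rewrite b1 /=.
    have [] := evP j 0 (lexx _); rewrite ?b1 // => _.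
    by rewrite mul0r expr0z mulr1 => ->; rewrite mul0r oppr0 expr0z.
  have [] := evN j 0 (lexx _); rewrite ?b1 // => _.
  rewrite mul0r expr0z mulr1 mul1r exprMn => /(canRL (mulKf _))->; rewrite ?expf_neq0 //.
  by rewrite mulr1 -exprnN.
- split; first by rewrite -beE.
  by have <- : - be = dl j (- be j) by rewrite {1}beE; apply/ffunP => i; rewrite !ffunE; case: eqP; rewrite ?oppr0.
move=> i g ij; rewrite XYE alE in_tsupp linearB linearZ /= -(tmon0 (qbichar hq0)) !tcoefU.
have [<-|_] := eqVneq ((dl j (al j) *+ d, 0) : lattice n) g.
  by rewrite /= ffunMnE ffunE (negPf ij) mul0rn.
have [<-|_] := eqVneq (0 : lattice n) g; first by rewrite ffunE.
by rewrite /GRing.scale /= mulr0 subr0 eqxx.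
Qed.

End ImageDegree.

Lemma hexp_phi_z j (tau : bool) i g : i != j ->
  g \in tsupp (phi (if tau then y j else x j)) -> g.1 i = 0.
Proof.
move=> ij; case: tau; rewrite ?(phi_x phiE) ?(phi_y phiE); last first.
  by rewrite tsuppU in_fset1 => /eqP->; rewrite ffunE.
move=> /tsuppM[g1 [g2 [s1 s2 ->]]].
move: s2; rewrite tsuppU in_fset1 => /eqP->; rewrite /= addr0.
move: s1; rewrite /a_d hTX in_tsupp linearB -(tmon0 (qbichar hq0)) /= !tcoefU.
have [<-|_] := eqVneq ((dl j d, 0) : lattice n) g1; first by rewrite /= ffunE (negPf ij).
have [<-|_] := eqVneq (0 : lattice n) g1; first by rewrite ffunE.
by rewrite subr0 eqxx.
Qed.

(** Since [phi W] is [t] times the image of [x_j] or [y_j], which involves no other [h_i], the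
    constancy of the exponent of [h_i] passes from [phi W] to the factor [t] by [homog_factors]. *)
Lemma normal_part W j (tau : bool) (c : {ffun 'I_n -> int}) : phi W != 0 -> xhomog (dl j ((-1) ^+ tau)) (phi W) ->
    (forall i g, i != j -> g \in tsupp (phi W) -> g.1 i = c i) ->
  exists t, W = hlift t * (if tau then y j else x j) /\
    forall i g, i != j -> g \in tsupp t -> g.1 i = c i.
Proof.
move=> nW hW cW; have [t [_ WE tE]] := xhomog_phi hd HA phiE hW.
have zE : zmon (dl j ((-1) ^+ tau)) = if tau then y j else x j.
  by rewrite zmon_dl; case: (tau); rewrite /= expr1.
rewrite zE in WE; exists t; split=> // i g ij sg.
have pE : phi W = t * phi (if tau then y j else x j) by rewrite {1}WE rmorphM /= tE.
have nt : t != 0 by apply: contraNneq nW => t0; rewrite pE t0 mul0r.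
have nz : phi (if tau then y j else x j) != 0.
  by apply: contraNneq nW => t0; rewrite pE t0 mulr0.
have [g2 s2] := tsupp_neq0 nz.
have /= := homog_factors (l := hexp i) (k := c i) (@coords_sep n) nt nz _ sg s2.
rewrite /hexp (hexp_phi_z ij s2) addr0; apply => g'.
by rewrite -pE; exact: cW.
Qed.

(** The constant exponents off [j] factor out as one monomial, leaving a Laurent polynomial in [h j]
    alone. *)
Lemma hlift_sum t j (c : {ffun 'I_n -> int}) : c j = 0 -> (forall i g, i != j -> g \in tsupp t -> g.1 i = c i) ->
  hlift t = (\sum_(g <- tsupp t) tcoef g t *: zpow (h j) (hi j) (g.1 j)) * hmon c.
Proof.
move=> cj ct; rewrite {1}[t]twalgE linear_sum mulr_suml big_seq [RHS]big_seq.
apply: eq_bigr => g sg; rewrite linearZ /= tlextU -scalerAl (hmon_split hd HA phiE j).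
congr (_ *: (_ * hmonomial _ _ _)); apply/ffunP => i; rewrite !ffunE.
by have [->|ij] := eqVneq i j; [rewrite subrr cj | rewrite subr0 (ct _ _ ij sg)].
Qed.

Lemma z_comm_hmon j (tau : bool) (c : {ffun 'I_n -> int}) : c j = 0 ->
  GRing.comm (if tau then y j else x j) (hmon c).
Proof.
move=> cj; apply: commr_prod => i _; have [->|ij] := eqVneq i j.
  by rewrite cj /= expr0; exact: commr1.
rewrite eq_sym in ij; apply: comm_zpow; apply: (gen_comm HA ij);
  by case: tau; rewrite ?inE ?eqxx ?orbT.
Qed.

Lemma z_h j (tau : bool) : exists2 k : K, k != 0 &
  (if tau then y j else x j) * h j = k *: (h j * (if tau then y j else x j)).
Proof.
by case: tau; [exists (q j)^-1; rewrite ?invr_eq0 ?(yh HA)|exists (q j); rewrite ?(xh HA)].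
Qed.

Lemma xyyx j (tau : bool) :
  (if tau then y j else x j) * (if tau then x j else y j) = a_d d (q j ^+ (1 - tau) *: h j).
Proof. by case: tau; rewrite ?expr0 ?scale1r ?(xy HA) ?(yx HA). Qed.

End Images.

(** All data attached to one index are gathered in a record, so that a single use of [choice] yields
    every function in the theorem. *)
Record image_data (K : fieldType) (n : nat) := ImageData {
  dw : 'I_n; dtau : bool; dm : int; dgam : K; dt : {ffun 'I_n -> int};
  dP : {poly K}; de : int; dP' : {poly K}; de' : int }.

Section ImageShape.
Variables (K : fieldType) (n d : nat) (q : 'I_n -> K).
Hypothesis hd : (0 < d)%N.
Hypothesis hq0 : forall i, q i != 0.
Variables (A : algType K) (x y h hi : 'I_n -> A).
Hypothesis HA : is_A_presentation d q x y h hi.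
Variable phi : {lrmorphism A -> qtorus hq0}.
Hypothesis phiE : forall i, [/\ phi (x i) = xT hq0 i, phi (y i) = yT hq0 d i,
  phi (h i) = hT hq0 i & phi (hi i) = hiT hq0 i].
Implicit Types (i j : 'I_n).
Notation hmon := (@hmonomial _ _ _ h hi).
Notation hlift := (@h_lift _ _ _ hq0 _ h hi).

Lemma image_shape (k : K) (u u' X Y : A) :
    k != 0 -> k ^+ d != 1 -> u * u' = 1 -> u' * u = 1 ->
    X * u = k *: (u * X) -> X * Y = a_d d (k *: u) -> Y * X = a_d d u ->
  exists D : image_data K n,
    let j := dw D in
    let L := laurent_eval (dP D) (de D) (h j) (hi j) in
    let L' := laurent_eval (dP' D) (de' D) (h j) (hi j) in
    [/\ [/\ dm D != 0, dgam D != 0, q j ^ ((-1) ^+ dtau D * dm D) = k &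
            dgam D ^+ d = k ^ (- ((dtau D)%:Z * d%:Z))],
        u = dgam D *: zpow (h j) (hi j) (dm D),
        L * L' * a_d d (q j ^+ (1 - dtau D) *: h j) =
          a_d d ((k * dgam D) *: zpow (h j) (hi j) (dm D)),
        X = L * hmon (dt D) * (if dtau D then y j else x j) /\
        Y = (if dtau D then x j else y j) * L' * hmon (- dt D) &
        [/\ phi X != 0, xhomog (dl j ((-1) ^+ dtau D)) (phi X) &
           forall i g, i != j -> g \in tsupp (phi X) -> g.1 i = dt D i]].
Proof.
move=> k0 kd uu' u'u Xu XY YX.
have [j [tau [m [gam [B uE [nX nY] [hX hY] h0]]]]] :=
  image_degree hd HA phiE k0 kd uu' u'u Xu XY YX.
(* The product [X Y] involves only [h_j], so off [j] the [h]-exponents of [X] and of [Y] are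
   constant and opposite. *)
have hom i g1 g2 : i != j -> g1 \in tsupp (phi X) -> g2 \in tsupp (phi Y) ->
    g1.1 i + g2.1 i = 0.
  move=> ij; apply: (homog_factors (l := hexp i) (@coords_sep n) nX nY) => g.
  exact: h0.
have [gX sX] := tsupp_neq0 nX; have [gY sY] := tsupp_neq0 nY.
(* The entry at [j] is set to 0 because all powers of [h_j] go into the Laurent polynomial. *)
pose c : {ffun 'I_n -> int} := [ffun i => if i == j then 0 else gX.1 i].
have cj : c j = 0 by rewrite ffunE eqxx.
have cX i g : i != j -> g \in tsupp (phi X) -> g.1 i = c i.
  move=> ij sg; rewrite ffunE (negPf ij); apply: (@addIr _ (gY.1 i)).
  by rewrite (hom _ _ _ ij sg sY) (hom _ _ _ ij sX sY).
have cY i g : i != j -> g \in tsupp (phi Y) -> g.1 i = (- c) i.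
  move=> ij sg; rewrite !ffunE (negPf ij); apply/eqP; rewrite -addr_eq0 addrC.
  by rewrite (hom _ _ _ ij sX sg).
have hY' : xhomog (dl j ((-1) ^+ ~~ tau)) (phi Y).
  by move: hY; case: (tau) => /=; rewrite ?expr1 ?expr0 ?opprK.
have [t1 [XE c1]] := normal_part hd HA phiE nX hX cX.
have [t2 [YE c2]] := normal_part hd HA phiE nY hY' cY.
have cj' : (- c) j = 0 by rewrite ffunE cj oppr0.
rewrite (hlift_sum hd HA phiE cj c1) in XE; rewrite (hlift_sum hd HA phiE cj' c2) in YE.
have hK' := hK HA j; have hiK' := hiK HA j.
set z := (if tau then y j else x j) in XE.
set z' := (if ~~ tau then y j else x j) in YE.
(* The normal form of [Y] has [z'] on the right, the required formula has it on the left. Moving it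
   across [h_j^a] costs [k1^a], which is absorbed into the coefficients of the second Laurent
   polynomial. *)
have [k1 k1n0 z'h] := z_h hq0 HA j (~~ tau).
have z'L (s : seq (lattice n)) (f : lattice n -> K) :
    (\sum_(g <- s) f g *: zpow (h j) (hi j) (g.1 j)) * z' =
    z' * \sum_(g <- s) (f g * (k1 ^ g.1 j)^-1) *: zpow (h j) (hi j) (g.1 j).
  rewrite mulr_suml mulr_sumr; apply: eq_bigr => g _.
  rewrite -scalerAl -scalerAr (qcomm_zpow (g.1 j) hK' hiK' k1n0 z'h) scalerA.
  by rewrite mulfVK // expfz_neq0.
have z'c : GRing.comm z' (hmon (- c)) by exact: (z_comm_hmon HA (~~ tau) cj').
rewrite -mulrA -z'c mulrA z'L in YE.
have [P [e PE]] := laurent_sum hK' hiK' (tsupp t1) (fun g => tcoef g t1) (fun g : lattice n => g.1 j).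
have [P' [e' PE']] := laurent_sum hK' hiK' (tsupp t2)
  (fun g => tcoef g t2 * (k1 ^ g.1 j)^-1) (fun g : lattice n => g.1 j).
rewrite PE in XE; rewrite PE' in YE.
exists (ImageData j tau m gam c P e P' e') => /=.
have z'E : z' = if tau then x j else y j by rewrite /z'; case: (tau).
split=> //; last by rewrite -z'E.
(* The identity for [L * L'] is the relation for [X * Y] rewritten with the two normal forms:
   [hmon c] and [hmon (- c)] cancel, and [z * z'] gives the factor [a_d]. *)
have := XY; rewrite uE scalerA => <-; rewrite XE YE.
set L := laurent_eval P e _ _; set L' := laurent_eval P' e' _ _.
have HH : hmon c * hmon (- c) = 1 by exact: (hmonN hd HA phiE).
have cW : GRing.comm (h j) (a_d d (q j ^+ (1 - tau) *: h j)).
  apply: commrB; last exact: commr1.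
  by apply: commrX; rewrite /GRing.comm -scalerAr -scalerAl.
have cWi : GRing.comm (hi j) (a_d d (q j ^+ (1 - tau) *: h j)).
  apply: commrB; last exact: commr1.
  by apply: commrX; rewrite /GRing.comm -scalerAr -scalerAl hK' hiK'.
have WL : GRing.comm (a_d d (q j ^+ (1 - tau) *: h j)) L'.
  by apply: comm_laurent; apply: commr_sym.
have Hh i : GRing.comm (hmon c) (h i) by apply: commr_sym; exact: (h_hmon_comm HA).
have Hhi i : GRing.comm (hmon c) (hi i).
  apply: commr_sym; apply: comm_hmon => l; last exact: (hihi_comm HA).
  by apply: commr_sym; exact: (hhi_comm HA).
have HL : GRing.comm (hmon c) L' by exact: comm_laurent.
have HW : GRing.comm (hmon c) (a_d d (q j ^+ (1 - tau) *: h j)).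
  apply: commrB; last exact: commr1.
  by apply: commrX; rewrite /GRing.comm -scalerAr -scalerAl Hh.
have zz : z * z' = a_d d (q j ^+ (1 - tau) *: h j) by rewrite z'E; exact: (xyyx HA).
rewrite -[RHS]mulrA [z * _]mulrA [z * _]mulrA zz -!mulrA; congr (_ * _).
by rewrite 2!mulrA [in RHS]HW -!mulrA [hmon c * _]mulrA HL -mulrA HH mulr1 WL.
Qed.

End ImageShape.

(** * Commutation between different indices *)

Theorem theorem3p1
  (K : fieldType) (n r d : nat) (hr0 : (0 < r)%N) (hrn : (r <= n)%N) (hd : (1 <= d)%N)
  (q : 'I_n -> K) (hq0 : forall i, q i != 0) (hqd : forall i, q i ^+ d != 1)
  (qt : 'I_r -> K) (hqt0 : forall i, qt i != 0) (hqtd : forall i, qt i ^+ d != 1)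
  (A : algType K) (x y h hi : 'I_n -> A)
  (HA : is_A_presentation d q x y h hi)
  (At : algType K) (xt yt ht hit : 'I_r -> At)
  (HAt : is_A_presentation d qt xt yt ht hit)
  (psi : {lrmorphism At -> A}) :
  exists (w : 'I_r -> 'I_n) (tau : 'I_r -> bool) (m : 'I_r -> int)
         (gamma b : 'I_r -> K) (t : 'I_r -> 'I_n -> int)
         (P P' : 'I_r -> {poly K}) (e e' : 'I_r -> int),
    [/\ injective w,
        (forall i, [/\ m i != 0, gamma i != 0 & b i != 0]),
        (* (i) *)
        (forall i, q (w i) ^ ((-1) ^+ tau i * m i) = qt i),
        (* (ii) *)
        (forall i l,
           q (w i) ^ (t l (w i) * (1 - (tau i)%:Z))
           * q (w i) ^ (- (t l (w i) * (tau i)%:Z))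
           * q (w l) ^ (- (t i (w l) * (1 - (tau l)%:Z)))
           * q (w l) ^ (t i (w l) * (tau l)%:Z) = 1) &
        (* (iii) and (iv) *)
        (forall i,
           [/\ laurent_eval (P i) (e i) (h (w i)) (hi (w i))
               * laurent_eval (P' i) (e' i) (h (w i)) (hi (w i))
               * a_d d (q (w i) ^+ (1 - tau i) *: h (w i))
               = a_d d ((qt i * gamma i) *: zpow (h (w i)) (hi (w i)) (m i)),
               gamma i ^+ d = qt i ^ (- ((tau i)%:Z * d%:Z)),
               psi (ht i) = gamma i *: zpow (h (w i)) (hi (w i)) (m i),
               psi (xt i) = laurent_eval (P i) (e i) (h (w i)) (hi (w i))
                            * (b i *: \prod_(j < n) zpow (h j) (hi j) (t i j))
                            * (if tau i then y (w i) else x (w i)) &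
               psi (yt i) = (if tau i then x (w i) else y (w i))
                            * laurent_eval (P' i) (e' i) (h (w i)) (hi (w i))
                            * ((b i)^-1 *: \prod_(j < n) zpow (h j) (hi j) (- t i j))])].
Proof.
have hd' : (0 < d)%N by [].
have [_ univ] := HA.
have [[phi phiE] _] := univ _ _ _ _ _ (qtorus_rels hq0 d).
have HtK i : ht i * hit i = 1 /\ hit i * ht i = 1.
  exact: (conj (hK HAt i) (hiK HAt i)).
have shape i := @image_shape K n d q hd' hq0 A x y h hi HA phi phiE (qt i)
  (psi (ht i)) (psi (hit i)) (psi (xt i)) (psi (yt i)) (hqt0 i) (hqtd i).
have {}shape i := shape i
  (ltac:(by rewrite -rmorphM (HtK i).1 rmorph1))
  (ltac:(by rewrite -rmorphM (HtK i).2 rmorph1))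
  (ltac:(by rewrite -!rmorphM (xh HAt) /= linearZ))
  (ltac:(by rewrite -rmorphM (xy HAt) rmorph_a_d /= linearZ))
  (ltac:(by rewrite -rmorphM (yx HAt) rmorph_a_d)).
have [D DE] := choice shape.
have signE (tau : bool) (k : K) : k != 0 -> forall z : int, k ^ ((-1) ^+ tau * z) = 1 -> k ^ z = 1.
  move=> kn0 z; case: tau; rewrite ?expr0 ?mul1r // expr1 mulN1r => E.
  by apply: invr_inj; rewrite invr1 -E invr_expz.
have qt1 i : qt i != 1 by apply: contraNneq (hqtd i) => ->; rewrite expr1n.
have phi_psi (u v : At) : GRing.comm u v ->
    phi (psi u) * phi (psi v) = 1 *: (phi (psi v) * phi (psi u)).
  by move=> uv; rewrite scale1r -!rmorphM uv.
(* If [w i = w l] with [i != l], then [psi (xt i)] has degree 1 or -1 in the [x]-variable at the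
   index of [psi (ht l)]. As [xt i] and [ht l] commute, [q (w l) ^ m l = 1], hence [qt l = 1]. *)
have w_inj : injective (fun i => dw (D i)).
  move=> i l /= wil; apply/eqP; apply: contraT => il.
  have [[ml0 gl0 ql _] hl _ _ _] := DE l; have [_ _ _ _ [Xi0 hXi _]] := DE i.
  have uv : GRing.comm (xt i) (ht l) by apply: (gen_comm HAt il); rewrite !inE eqxx ?orbT.
  have := phi_psi _ _ uv; rewrite hl linearZ /= (phi_zpow_h phiE) => E.
  have {}E : phi (psi (xt i)) * tmon (qbichar hq0) ((dl (dw (D l)) (dm (D l)), 0) : lattice n) =
      1 *: (tmon (qbichar hq0) ((dl (dw (D l)) (dm (D l)), 0) : lattice n) * phi (psi (xt i))).
    by apply: (scalerI gl0); rewrite scalerAr E !scale1r scalerAl.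
  have [g1 [g2 [s1 s2 c12]]] := bichar_of_qcomm (@coords_sep n) Xi0 (U_neq0 hq0 _) E.
  move: s2 c12; rewrite tsuppU in_fset1 => /eqP-> /=.
  rewrite qpair0l mulr1 qpair_dr (hXi _ s1) ffunE wil eqxx => /(signE _ _ (hq0 _)) qm.
  by have := qt1 l; rewrite -ql mulrC -exprz_exp qm exp1rz eqxx.
(* Every scalar is already part of the Laurent polynomials, so [b i = 1]. *)
exists (fun i => dw (D i)), (fun i => dtau (D i)), (fun i => dm (D i)), (fun i => dgam (D i)),
  (fun=> 1), (fun i => dt (D i)), (fun i => dP (D i)), (fun i => dP' (D i)),
  (fun i => de (D i)), (fun i => de' (D i)).
split=> //.
- by move=> i; have [[]] := DE i; rewrite oner_neq0.
- by move=> i; have [[]] := DE i.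
- move=> i l; have [->|il] := eqVneq i l.
    rewrite -!expfzDr //; set a := (X in _ ^ X); suff -> : a = 0 by rewrite expr0z.
    by rewrite /a addrAC addrNK addrC; lia.
  have [_ _ _ _ [Xi0 hXi cXi]] := DE i; have [_ _ _ _ [Xl0 hXl cXl]] := DE l.
  (* For [i != l], condition (ii) says that leading monomials of the commuting elements [psi (xt i)]
     and [psi (xt l)] commute. Their exponents at the other's index are [dt] entries because
     [w i != w l]. *)
  have uv : GRing.comm (xt i) (xt l) by apply: (gen_comm HAt il); rewrite !inE eqxx ?orbT.
  have [g1 [g2 [s1 s2 c12]]] := bichar_of_qcomm (@coords_sep n) Xi0 Xl0 (phi_psi _ _ uv).
  have wil : dw (D i) != dw (D l) by apply: contra il => /eqP/w_inj->.
  move: c12; rewrite mul1r /= (_ : g1 = (g1.1, dl (dw (D i)) ((-1) ^+ dtau (D i)))); last first.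
    by rewrite -(hXi _ s1); case: (g1).
  rewrite (_ : g2 = (g2.1, dl (dw (D l)) ((-1) ^+ dtau (D l)))); last first.
    by rewrite -(hXl _ s2); case: (g2).
  rewrite !qpair_dl /= (cXl _ _ wil s2) (cXi _ _ _ s1) 1?eq_sym // => E.
  have qn0 z : q (dw (D l)) ^ z != 0 by rewrite expfz_neq0.
  rewrite -mulrA -!expfzDr //.
  have -> : dt (D l) (dw (D i)) * (1 - (dtau (D i))%:Z) - dt (D l) (dw (D i)) * (dtau (D i))%:Z =
      (-1) ^+ dtau (D i) * dt (D l) (dw (D i)).
    by case: (dtau (D i)) => /=; rewrite ?expr1 ?expr0; lia.
  rewrite E -expfzDr //; set a := (X in _ ^ X); suff -> : a = 0 by rewrite expr0z.
  by rewrite /a; case: (dtau (D l)) => /=; rewrite ?expr1 ?expr0; lia.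
move=> i; have [[_ _ _ gamE] htE LE [XE YE] _] := DE i; split=> //.
- by rewrite XE scale1r.
rewrite YE invr1 scale1r; congr (_ * _); apply: eq_bigr => j _.
by rewrite ffunE.
Qed.
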